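(* Let $n\ge 1$ be an integer and write $n=6p+d$ with integers $p\ge 0$ and $0\le d\le 5$. Let $k$ be a field, $S=k[x_1,\ldots,x_n]$, and let $NI(P_n^2)\subseteq S$ be the closed neighborhood ideal of the square of the path graph $P_n$. Then $$\operatorname{reg}\left(\frac{S}{NI(P_n^2)}\right)=\operatorname{depth}\left(\frac{S}{NI(P_n^2)}\right)=\begin{cases}4p,& d\in\{0,1\}\\ 4p+1,& d=2\\ 4p+2,& d\in\{3,4\}\\ 4p+3,& d=5,\end{cases}$$ where $\operatorname{reg}$ denotes the Castelnuovo--Mumford regularity.
   Context: The path graph $P_n$ has vertex set $\{x_1,\ldots,x_n\}$ and edges $\{x_i,x_{i+1}\}$ for $1\le i\le n-1$. Its square $P_n^2$ has the same vertex set and edge set $\{\{x_i,x_{i+1}\}:1\le i\le n-1\}\cup\{\{x_i,x_{i+2}\}:1\le i\le n-2\}$. For a finite simple graph $G$ and a vertex $x$, $N(x)$ is the set of vertices adjacent to $x$, and $N[x]=N(x)\cup\{x\}$ is the closed neighborhood of $x$. For a finite simple graph $G$ with vertices $x_1,\ldots,x_n$ (identified with the variables of $S=k[x_1,\ldots,x_n]$), the closed neighborhood ideal is the squarefree monomial ideal $NI(G)=\left(\prod_{x_j\in N[x_i]}x_j : 1\le i\le n\right)\subseteq S$. The ring $S$ carries the standard grading, and depth is taken with respect to the graded maximal ideal $(x_1,\ldots,x_n)$. *)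

(* Defs.v *)
From HB Require Import structures.
From mathcomp Require Import all_boot all_order all_algebra.
From mathcomp Require Import mpoly.

Set Implicit Arguments.
Unset Strict Implicit.
Unset Printing Implicit Defensive.

Import GRing.Theory.
Local Open Scope ring_scope.

(* Ideals of S = {mpoly k[n]} are Prop-valued predicates on S, and S/I is      *)
(* handled through representatives in S.                                      *)

Section Ideals.
Variables (k : fieldType) (n : nat).
Local Notation S := {mpoly k[n]}.

Definition gen_ideal (T : finType) (g : T -> S) : S -> Prop :=
  fun f => exists c : T -> S, f = \sum_t c t * g t.

(* I + (s_0, ..., s_(m-1)) *)
Definition add_ideal (I : S -> Prop) (s : seq S) : S -> Prop :=
  fun f => exists c : nat -> S, I (f - \sum_(i < size s) c i * s`_i).

(* The graded maximal ideal (x_1, ..., x_n): zero constant term. *)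
Definition max_ideal : S -> Prop := fun f => f@_(0%MM) = 0.

End Ideals.

Section Graph.
Variable n : nat.

Definition closed_nbhd (e : rel 'I_n) (x : 'I_n) : {set 'I_n} :=
  [set y | (y == x) || e x y].

(* x_1, ..., x_n are indexed from 0: the vertex i : 'I_n stands for x_(i+1). *)
Definition path_square : rel 'I_n := fun i j =>
  [|| j == i.+1 :> nat, i == j.+1 :> nat, j == i.+2 :> nat | i == j.+2 :> nat].

Definition NI (k : fieldType) (e : rel 'I_n) : {mpoly k[n]} -> Prop :=
  gen_ideal (fun i : 'I_n => \prod_(j in closed_nbhd e i) 'X_j).

End Graph.

Section Depth.
Variables (k : fieldType) (n : nat).
Local Notation S := {mpoly k[n]}.

(* s is an (S/I)-regular sequence contained in the graded maximal ideal. *)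
Definition regular_seq (I : S -> Prop) (s : seq S) : Prop :=
  [/\ forall f, f \in s -> max_ideal f,
      forall i, (i < size s)%N -> forall g,
        add_ideal I (take i s) (s`_i * g) -> add_ideal I (take i s) g
    & ~ add_ideal I s 1].

(* depth (S/I) = d *)
Definition quot_depth (I : S -> Prop) (d : nat) : Prop :=
  (exists2 s, size s = d & regular_seq I s) /\
  (forall s, regular_seq I s -> (size s <= d)%N).

End Depth.

Section Regularity.
Variables (k : fieldType) (n : nat).
Local Notation S := {mpoly k[n]}.

(* p is an admissible entry of a degree-preserving map S(-a) -> S(-b). *)
Definition shift_homog (a b : nat) (p : S) : bool :=
  (p == 0) || ((b <= a)%N && (p \is (a - b)%N.-homog)).

(* Data of a complex ... -> F_1 -> F_0 -> S/I of graded free modules,         *)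
(* F_i = \bigoplus_j S(- shift i j), with elements of F_i as row vectors and  *)
(* maps acting by right multiplication; aug lists representatives in S of the *)
(* images in S/I of the basis of F_0.  Natural-number shifts suffice, since   *)
(* S/I lives in nonnegative degrees.                                          *)
Record free_complex := FreeComplex {
  rk : nat -> nat;
  shift : forall i, 'I_(rk i) -> nat;
  diff : forall i, 'M[S]_(rk i.+1, rk i);
  aug : 'cV[S]_(rk 0)
}.

Definition graded (F : free_complex) : Prop :=
  (forall i j l,
     shift_homog (@shift F i.+1 j) (@shift F i l) (diff F i j l)) /\
  (forall j, shift_homog (@shift F 0 j) 0 (aug F j 0)).

Definition exact_over (I : S -> Prop) (F : free_complex) : Prop :=
  [/\ exists v : 'rV_(rk F 0), I ((v *m aug F) 0 0 - 1),
      forall v : 'rV_(rk F 0),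
        I ((v *m aug F) 0 0) <-> exists w, v = w *m diff F 0
    & forall i (v : 'rV_(rk F i.+1)),
        v *m diff F i = 0 <-> exists w, v = w *m diff F i.+1].

Definition minimal (F : free_complex) : Prop :=
  forall i j l, max_ideal (diff F i j l).

Definition min_free_resolution (I : S -> Prop) (F : free_complex) : Prop :=
  [/\ graded F, exact_over I F & minimal F].

(* reg (S/I) = r, i.e. r = max {b - i : beta_(i,b) (S/I) <> 0}, where          *)
(* beta_(i,b) is the number of summands S(-b) of F_i in the minimal graded    *)
(* free resolution F of S/I; F is unique up to isomorphism, so that r does    *)
(* not depend on its choice.                                                  *)
Definition quot_reg (I : S -> Prop) (r : nat) : Prop :=
  exists2 F, min_free_resolution I F &
    (exists i j, @shift F i j = (i + r)%N) /\
    (forall i j, (@shift F i j <= i + r)%N).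

End Regularity.

(* Main.v *)
(* Write an up-closed family D of vertex sets for the squarefree ideal of the
polynomials whose monomials have their supports in D. All the ideals met here
have minimal nonfaces [l, l + q) and [i, i + 5) for l < i < n - 2, cut at n;
NI(P_n^2) is the case l = 0, q = 3. The common value is n - ceil(n / 3).

Regularity: x_l occurs only in the generator x_l m of [l, l + q). If I' is
generated by the other ones, then I' and I' : m are again interval ideals, and
the mapping cone of x_l times a lift of m : S/(I' : m) -> S/I' is a minimal
resolution, because every entry of the comparison map is a multiple of x_l.

Depth, lower bound: exact sequences 0 -> S/(I:x) -> S/I -> S/(I+x) -> 0 unfold
S/I into quotients by at most ceil(n / 3) variables; on all of these the first
n - ceil(n / 3) elementary symmetric polynomials form a regular sequence.

Depth, upper bound: the variables with index divisible by 3 generate an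
associated prime. Adjoining the other variables one at a time, graded Nakayama
gives a nonzero Koszul cohomology class of S/I in degree n - ceil(n / 3),
whereas a regular sequence of length m kills the cohomology in degrees < m. *)
Require Import Defs.
From HB Require Import structures.
From mathcomp Require Import all_boot all_order all_algebra.
From mathcomp Require Import mpoly zify ring.
From Stdlib Require Import ClassicalEpsilon.

Set Implicit Arguments.
Unset Strict Implicit.
Unset Printing Implicit Defensive.

Import GRing.Theory.
Local Open Scope ring_scope.

(** * Graded components and ideals *)

Section Ideals.
Variables (k : fieldType) (n : nat).
Local Notation S := {mpoly k[n]}.
Implicit Types (I J : S -> Prop) (f g p q : S) (d e : nat).

Lemma mcoeff_pihomog d p m :
  (pihomog mdeg d p)@_m = if mdeg m == d then p@_m else 0.
Proof.
rewrite pihomogE raddf_sum /=.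
under eq_bigr => i _ do rewrite mcoeffZ mcoeffX.
case: ifP => md.
- have [mp|mp] := boolP (m \in msupp p).
    rewrite -big_filter (bigD1_seq m) ?filter_uniq ?msupp_uniq //=; last first.
      by rewrite mem_filter md.
    rewrite eqxx mulr1 big1 ?addr0 // => i /negPf ->; by rewrite mulr0.
  rewrite big_seq_cond big1 => [|i /andP[ip _]].
    by apply/esym/eqP; rewrite mcoeff_eq0.
  by case: eqP ip => [->|]; rewrite ?(negPf mp) ?mulr0.
rewrite big1 // => i /eqP mi; case: eqP => [E|]; rewrite ?mulr0 //.
by rewrite -E mi eqxx in md.
Qed.

(** When [p] is expanded into graded components, only the one of degree [d - e] contributes. *)
Lemma pihomogM d e p q : q \is e.-homog ->
  pihomog mdeg d (p * q) = if (e <= d)%N then pihomog mdeg (d - e)%N p * q else 0.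
Proof.
move=> hq.
have hi (i : nat) : pihomog mdeg i p * q \is (i + e).-homog.
  exact: dhomogM (pihomogP _ _ _) hq.
rewrite {1}(pihomog_partitionE (leqnn (mmeasure mdeg p))) mulr_suml raddf_sum /=.
case: leqP => [led|ltd]; last first.
  apply: big1 => i _; apply: (pihomog_ne0 _ (hi i)); apply/eqP; lia.
have [lt|ge] := ltnP (d - e) (mmeasure mdeg p).
  rewrite (bigD1 (Ordinal lt)) //= pihomog_dE; last first.
    by have := hi (d - e)%N; rewrite subnK.
  rewrite big1 ?addr0 // => i ne; apply: (pihomog_ne0 _ (hi i)).
  by apply: contraNneq ne => E; apply/eqP/val_inj => /=; lia.
rewrite big1 => [|i _]; last first.
  by apply: (pihomog_ne0 _ (hi i)); apply/eqP; have := ltn_ord i; lia.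
suff -> : pihomog mdeg (d - e) p = 0 by rewrite mul0r.
apply/mpolyP => m; rewrite mcoeff_pihomog mcoeff0; case: eqP => // md.
by apply/eqP; rewrite mcoeff_eq0; apply: msize_mdeg_ge; rewrite md.
Qed.

Record is_ideal I : Prop := IsIdeal {
  ideal0 : I 0;
  idealD : forall f g, I f -> I g -> I (f + g);
  idealM : forall p f, I f -> I (p * f) }.

Definition homog_ideal I := forall d f, I f -> I (pihomog mdeg d f).

Definition nonzero_divisor I f := forall g, I (f * g) -> I g.

Definition add1 I f : S -> Prop := fun g => exists c, I (g - c * f).

Section IdealTheory.
Variables (I : S -> Prop) (hI : is_ideal I).

Lemma idealN f : I f -> I (- f).
Proof. by move=> /(idealM hI (-1)); rewrite mulN1r. Qed.

Lemma idealB f g : I f -> I g -> I (f - g).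
Proof. by move=> If /idealN; exact: (idealD hI). Qed.

Lemma ideal_trans g f : I g -> I (f - g) -> I f.
Proof. by move=> Ig /(idealD hI)/(_ Ig); rewrite subrK. Qed.

Lemma ideal_sum (T : Type) (r : seq T) (P : pred T) (F : T -> S) :
  (forall i, P i -> I (F i)) -> I (\sum_(i <- r | P i) F i).
Proof. by apply: big_ind; [exact: ideal0 hI | exact: idealD hI]. Qed.

Lemma ideal_sum_seq (T : eqType) (r : seq T) (F : T -> S) :
  (forall i, i \in r -> I (F i)) -> I (\sum_(i <- r) F i).
Proof. by move=> h; rewrite big_seq; apply: ideal_sum. Qed.

Lemma is_ideal_add1 f : is_ideal (add1 I f).
Proof.
split.
- by exists 0; rewrite mul0r subr0; exact: ideal0 hI.
- move=> g h [c Ic] [c' Ic']; exists (c + c').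
  rewrite (_ : _ - _ = (g - c * f) + (h - c' * f)); last by ring.
  exact: idealD hI _ _ Ic Ic'.
- move=> p g [c Ic]; exists (p * c); rewrite -mulrA -mulrBr.
  exact: idealM hI _ _ Ic.
Qed.

Lemma sub_add1 f g : I g -> add1 I f g.
Proof. by move=> Ig; exists 0; rewrite mul0r subr0. Qed.

Lemma add1_gen f : add1 I f f.
Proof. by exists 1; rewrite mul1r subrr; exact: ideal0 hI. Qed.

Lemma homog_ideal_add1 d f : homog_ideal I -> f \is d.-homog ->
  homog_ideal (add1 I f).
Proof.
move=> hh hf e g [c Ic].
exists (if (d <= e)%N then pihomog mdeg (e - d)%N c else 0).
have := hh e _ Ic; rewrite pihomogB (pihomogM _ _ hf).
by case: ifP; rewrite ?mul0r.
Qed.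

Lemma ideal_pihomog f : (forall d, I (pihomog mdeg d f)) -> I f.
Proof.
move=> h; rewrite (pihomog_partitionE (leqnn (mmeasure mdeg f))).
exact: ideal_sum.
Qed.

Lemma nonzero_divisorM f g : nonzero_divisor I f -> nonzero_divisor I g ->
  nonzero_divisor I (f * g).
Proof. by move=> hf hg h; rewrite -mulrA => /hf/hg. Qed.

Lemma nonzero_divisor1 : nonzero_divisor I 1.
Proof. by move=> g; rewrite mul1r. Qed.

Lemma nonzero_divisor_prod (T : Type) (r : seq T) (P : pred T) (F : T -> S) :
  (forall i, P i -> nonzero_divisor I (F i)) ->
  nonzero_divisor I (\prod_(i <- r | P i) F i).
Proof. by apply: big_ind; [exact: nonzero_divisor1|exact: nonzero_divisorM]. Qed.

Lemma nonzero_divisor_congr f g : I (f - g) -> nonzero_divisor I f ->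
  nonzero_divisor I g.
Proof.
move=> fg hf h gh; apply: hf; apply: (ideal_trans gh).
by rewrite -mulrBl mulrC; exact: idealM hI _ _ fg.
Qed.

End IdealTheory.

Lemma add1_congr I J f : (forall g, I g <-> J g) ->
  forall g, add1 I f g <-> add1 J f g.
Proof. by move=> IJ g; split=> -[c /IJ]; exists c. Qed.

Lemma add1C I f g h : add1 (add1 I f) g h -> add1 (add1 I g) f h.
Proof.
by case=> c [d Id]; exists d, c; move: Id; rewrite -!addrA [- _ - _]addrC.
Qed.

(** * Weakly regular sequences *)

(** The last quotient may be zero: the colon ideals met later can be the whole ring. *)
Fixpoint wreg I (s : seq S) : Prop :=
  if s is f :: s' then nonzero_divisor I f /\ wreg (add1 I f) s' else True.

Lemma wreg_congr I J s : (forall g, I g <-> J g) -> wreg I s -> wreg J s.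
Proof.
elim: s I J => //= f s ih I J IJ [hf hs]; split; first by move=> g /IJ/hf/IJ.
by apply: ih hs; exact: add1_congr.
Qed.

Lemma wreg_full I s : (forall f, I f) -> wreg I s.
Proof.
elim: s I => //= f s ih I h; split=> //; apply: ih => g; exists 0; exact: h.
Qed.

(* In [0 -> S/(I:x) -> S/I -> S/(I+x) -> 0] both ends are kept exact by *)
(* killing a nonzero divisor, so regularity passes to the middle term. *)
Lemma wreg_extension I x s : is_ideal I ->
  wreg (fun f => I (x * f)) s -> wreg (add1 I x) s -> wreg I s.
Proof.
elim: s I => //= f s ih I hI [hc hcs] [ha has].
have hf : nonzero_divisor I f.
  move=> g Ifg; have [|c Ic] := ha g; first exact: sub_add1.
  suff: I (x * c) by move=> /(idealD hI Ic); rewrite mulrC subrK.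
  apply: hc; have := idealB hI Ifg (idealM hI f Ic).
  by rewrite (_ : _ - _ = x * (f * c)) //; ring.
split=> //; apply: ih; first exact: is_ideal_add1.
  (* Adding [f] commutes with the colon by [x]: if [x * g - c * f] is in [I], then [f * c], hence
     [c], lies in [I + (x)]. *)
  apply: wreg_congr hcs => g; split.
    by case=> c Ic; exists (x * c); rewrite -mulrA -mulrBr.
  case=> c Ic; have [|e Ie] := ha c.
    by exists g; have := idealN hI Ic; congr I; ring.
  exists e; rewrite mulrBr; apply: (ideal_trans hI (idealM hI f Ie)).
  by have := Ic; congr I; ring.
by apply: wreg_congr has => g; split; exact: add1C.
Qed.

(* If [b * m] is in [I], then [m] is in [I + (x^N)] for every [N], which puts *)
(* all graded components of [m] in [I]. *)
Lemma nonzero_divisor_descent I x b : is_ideal I -> homog_ideal I ->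
  x \is 1.-homog -> nonzero_divisor I x -> nonzero_divisor (add1 I x) b ->
  nonzero_divisor I b.
Proof.
move=> hI hh hx zx zb m Ibm.
have step N : forall m, I (b * m) -> exists m', I (m - x ^+ N * m').
  elim: N => [|N ih] {Ibm} {}m Ibm.
    by exists m; rewrite mul1r subrr; exact: ideal0 hI.
  have [|c Ic] := zb m; first exact: sub_add1.
  have [|m' Im'] := ih c.
    apply: zx; have := idealB hI Ibm (idealM hI b Ic); congr I; ring.
  exists m'; apply: (ideal_trans hI Ic); have := idealM hI x Im'.
  congr I; rewrite exprS; ring.
apply: (ideal_pihomog hI) => d.
(* A multiple of [x ^+ d.+1] has no component in degree [d]. *)
have [m' Im'] := step d.+1 m Ibm.
have hxN : x ^+ d.+1 \is d.+1.-homog by rewrite -[in X in X.-homog](mul1n d.+1); exact: dhomogMn.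
have := hh d _ Im'; rewrite pihomogB mulrC (pihomogM _ _ hxN) ltnn subr0.
by [].
Qed.

(** A case of the permutability of homogeneous regular sequences: [x] passes the elements of [s] one
    by one, and the descent lemma makes each of them a nonzero divisor before [x] is killed. *)
Lemma wreg_move_last I x s : is_ideal I -> homog_ideal I ->
  (forall f, f \in s -> exists d, f \is d.-homog) ->
  x \is 1.-homog -> nonzero_divisor I x -> wreg (add1 I x) s ->
  wreg I (rcons s x).
Proof.
elim: s I => [//|b s ih] I hI hh hs hx zx /= [zb hr].
split; first exact: (nonzero_divisor_descent hI hh hx).
have [d hb] := hs b (mem_head _ _).
apply: ih => //; first exact: is_ideal_add1.
- exact: homog_ideal_add1 hb.
- by move=> f fs; apply: hs; rewrite in_cons fs orbT.
(* If [x * m - c * b] is in [I], then [c] is some [e * x] modulo [I], and [x] cancels from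
   [x * (m - e * b)]. *)
- move=> m [c Ic]; have [|e Ie] := zb c.
    exists m; have := idealN hI Ic; congr I; ring.
  exists e; apply: zx; apply: (ideal_trans hI Ic).
  have := idealM hI b Ie; rewrite [X in I X](_ : _ = c * b - x * (e * b)); last ring.
  move/(idealN hI) => /(idealN hI); congr I; ring.
- by apply: wreg_congr hr => g; split; exact: add1C.
Qed.

Lemma wreg_rcons I s x : wreg I (rcons s x) <->
  wreg I s /\ nonzero_divisor (foldl add1 I s) x.
Proof.
elim: s I => [|f s ih] I /=; first by split=> [[]|[]].
by rewrite ih; split=> [[? []]|[[? ?] ?]].
Qed.

Lemma foldl_add1_mono I s f : I f -> foldl add1 I s f.
Proof. by elim: s I => //= a s ih I If; apply/ih/sub_add1. Qed.

Lemma is_ideal_foldl I s : is_ideal I -> is_ideal (foldl add1 I s).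
Proof. by elim: s I => //= a s ih I hI; apply/ih/is_ideal_add1. Qed.

Lemma add_ideal_foldl I s f : add_ideal I s f <-> foldl add1 I s f.
Proof.
elim: s I f => [|a s ih] I f /=.
  split=> [[c]|If]; first by rewrite big_ord0 subr0.
  by exists (fun=> 0); rewrite big_ord0 subr0.
rewrite -ih; split=> -[c].
  rewrite big_ord_recl /= => Ic; exists (fun i => c i.+1), (c 0%N).
  by rewrite -addrA -opprD [_ + c 0%N * _]addrC.
case=> e Ie; exists (fun i => if i is j.+1 then c j else e).
by rewrite big_ord_recl /= opprD addrA addrAC.
Qed.

Lemma wregP I s : wreg I s <-> forall i, (i < size s)%N -> forall g,
  add_ideal I (take i s) (s`_i * g) -> add_ideal I (take i s) g.
Proof.
elim: s I => [|a s ih] I //=; split.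
  case=> za /ih hs [|i] /=.
    by move=> _ g; rewrite !add_ideal_foldl /=; exact: za.
  rewrite ltnS => lti g; have := hs i lti g.
  by rewrite !add_ideal_foldl.
move=> h; split.
  by move=> g; have := h 0%N isT g; rewrite /= !add_ideal_foldl.
by apply/ih => i lti g; have := h i.+1 lti g; rewrite !add_ideal_foldl.
Qed.

End Ideals.

(** * Squarefree monomial ideals *)

Section Squarefree.
Variables (k : fieldType) (n : nat).
Local Notation S := {mpoly k[n]}.
Implicit Types (f g p q : S) (U A B Z : {set 'I_n}) (D : pred {set 'I_n}).

Definition mnm_support (m : 'X_{1..n}) : {set 'I_n} := [set i | m i != 0%N].

Definition upclosed D := forall A B, A \subset B -> D A -> D B.

(* The squarefree monomial ideal whose non-faces are the sets in [D]. *)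
Definition sqf D : S -> Prop := fun f => forall m, ~~ D (mnm_support m) -> f@_m = 0.

Lemma mnm_supportD m1 m2 :
  mnm_support (m1 + m2)%MM = mnm_support m1 :|: mnm_support m2.
Proof. by apply/setP=> i; rewrite !inE mnmDE addn_eq0 negb_and. Qed.

Lemma mnm_supportU i : mnm_support U_(i)%MM = [set i].
Proof. by apply/setP=> j; rewrite !inE mnm1E (eq_sym j); case: (i == j). Qed.

Lemma mnm_support_mesym1 A : mnm_support (mesym1 A) = A.
Proof. by apply/setP=> j; rewrite !inE mnmE; case: (j \in A). Qed.

Lemma mesym1_lem A m : (mesym1 A <= m)%MM = (A \subset mnm_support m).
Proof.
apply/forallP/subsetP => [h i iA|h i].
  by have := h i; rewrite mnmE iA inE lt0n.
by rewrite mnmE; have [/h|] := boolP (i \in A); rewrite ?inE ?lt0n.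
Qed.

Lemma sqf_congr D D' : D =1 D' -> forall f, sqf D f <-> sqf D' f.
Proof. by move=> e f; split=> h m; have := h m; rewrite e. Qed.

Lemma is_ideal_sqf D : upclosed D -> is_ideal (sqf D).
Proof.
move=> up; split.
- by move=> m _; rewrite mcoeff0.
- by move=> f g hf hg m Dm; rewrite mcoeffD hf // hg // addr0.
- move=> p f hf m Dm; rewrite mcoeffM big1 // => -[m1 m2] /= /eqP E.
  rewrite (hf (val m2)) ?mulr0 //; apply: contraNN Dm; apply: up.
  by move/(congr1 mnm_support): E; rewrite mnm_supportD => ->; exact: subsetUr.
Qed.

Lemma homog_ideal_sqf D : homog_ideal (sqf D).
Proof.
by move=> d f hf m Dm; rewrite mcoeff_pihomog hf //; case: ifP.
Qed.

(** Multiplication by a monomial translates exponents, and membership depends on supports only. *)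
Lemma sqf_colon D m0 f :
  sqf D ('X_[m0] * f) <-> sqf (fun U => D (U :|: mnm_support m0)) f.
Proof.
rewrite mulrC; split=> h m Dm.
  by have := h (m0 + m)%MM; rewrite mcoeffMX mnm_supportD setUC; apply.
have [le|nle] := boolP (m0 <= m)%MM.
  rewrite -(submK le) addmC mcoeffMX h //.
  by rewrite -mnm_supportD submK.
rewrite mcoeffM big1 // => -[m1 m2] /= /eqP E; rewrite mcoeffX.
case: eqP => [e2|]; rewrite ?mulr0 //.
by case/negP: nle; rewrite e2; move: (lem_addl (bmnm m1) (bmnm m2)); rewrite -E.
Qed.

Lemma sqf_colonX D i f :
  sqf D ('X_i * f) <-> sqf (fun U => D (i |: U)) f.
Proof.
rewrite sqf_colon mnm_supportU.
by apply: sqf_congr => U; rewrite setUC.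
Qed.

(** A term with support in [D] but not in [D'] is divisible by the squarefree monomial with exponent
    vector [mesym1 A]. *)
Lemma sqf_add D D' A : upclosed D' -> (forall U, D U = D' U || (A \subset U)) ->
  forall f, sqf D f <-> add1 (sqf D') 'X_[mesym1 A] f.
Proof.
move=> up' DE f.
have up : upclosed D.
  move=> B C BC; rewrite !DE => /orP[/(up' _ _ BC)->//|AB].
  by rewrite (subset_trans AB BC) orbT.
have h' := is_ideal_sqf up'; have hA := is_ideal_add1 h' 'X_[mesym1 A].
split=> [h|[c h]].
  rewrite (mpolyE f); apply: (ideal_sum_seq hA) => m mf.
  rewrite -mul_mpolyC; apply: (idealM hA).
  have : D (mnm_support m).
    by apply: contraLR mf => /h /eqP; rewrite mcoeff_eq0.
  rewrite DE => /orP[D'm|Am].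
    apply: sub_add1 => m' D'm'; rewrite mcoeffX; case: eqP => // e.
    by rewrite -e D'm in D'm'.
  rewrite -mesym1_lem in Am; exists 'X_[m - mesym1 A].
  by rewrite -mpolyXD submK // subrr; exact: ideal0 h'.
rewrite -(subrK (c * 'X_[mesym1 A]) f); apply: (idealD (is_ideal_sqf up)).
  by move=> m; rewrite DE negb_or => /andP[D'm _]; exact: h.
apply: (idealM (is_ideal_sqf up)) => m; rewrite DE negb_or => /andP[_].
rewrite mcoeffX; case: eqP => // <-.
by rewrite mnm_support_mesym1 subxx.
Qed.

Lemma mpolyX_mesym1 A : 'X_[mesym1 A] = \prod_(i in A) 'X_i :> S.
Proof.
rewrite mprodXE; congr 'X_[ _ ]; apply/mnmP => j.
rewrite mnm_sumE (eq_bigr (fun i => (i == j : nat))) => [|i _]; last by rewrite mnm1E.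
rewrite mnmE; have [jA|jA] := boolP (j \in A).
  by rewrite (bigD1 j) //= eqxx big1 // => i /andP[_ /negPf ->].
by rewrite big1 // => i iA; case: eqP => // e; rewrite -e iA in jA.
Qed.

Lemma is_ideal_gen_ideal (T : finType) (g : T -> S) : is_ideal (gen_ideal g).
Proof.
split.
- by exists (fun=> 0); rewrite big1 // => t _; rewrite mul0r.
- move=> u v [c ->] [c' ->]; exists (fun t => c t + c' t).
  by rewrite -big_split; apply: eq_bigr => t _; rewrite mulrDl.
- move=> p u [c ->]; exists (fun t => p * c t).
  by rewrite mulr_sumr; apply: eq_bigr => t _; rewrite mulrA.
Qed.

Lemma gen_ideal_sqf (T : finType) (F : T -> {set 'I_n}) f :
  gen_ideal (fun t => \prod_(j in F t) 'X_j) f <->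
  sqf (fun U => [exists t, F t \subset U]) f.
Proof.
set D := fun U => _.
have up : upclosed D.
  by move=> A B AB /existsP[t tA]; apply/existsP; exists t; exact: subset_trans AB.
have hD := is_ideal_sqf up.
have hg := is_ideal_gen_ideal (fun t => \prod_(j in F t) 'X_j : S).
split.
  case=> c ->; apply: (ideal_sum hD) => t _; apply: (idealM hD).
  rewrite -mpolyX_mesym1 => m; rewrite mcoeffX; case: eqP => // <- /existsP[].
  by exists t; rewrite mnm_support_mesym1.
move=> h; rewrite (mpolyE f); apply: (ideal_sum_seq hg) => m mf.
rewrite -mul_mpolyC; apply: (idealM hg).
have /existsP[t] : D (mnm_support m).
  by apply: contraLR mf => /h /eqP; rewrite mcoeff_eq0.
rewrite -mesym1_lem => /submK <-; rewrite mpolyXD mpolyX_mesym1.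
exists (fun t' => if t' == t then 'X_[m - mesym1 (F t)] else 0).
rewrite (bigD1 t) //= eqxx [X in _ = _ + X]big1 ?addr0 // => t' /negPf ->.
by rewrite mul0r.
Qed.

(** * Elementary symmetric polynomials as a regular sequence *)

Definition esym_seq v : seq S := [seq mesym n k i.+1 | i <- iota 0 v].

Lemma esym_seq_homog v f : f \in esym_seq v -> exists d, f \is d.-homog.
Proof. by case/mapP => i _ ->; exists i.+1; exact: dhomog_mesym. Qed.

Lemma esym_seqS v : esym_seq v.+1 = rcons (esym_seq v) (mesym n k v.+1).
Proof. by rewrite /esym_seq -{1}addn1 iotaD map_cat cats1. Qed.

(** [sqf (meets Z)] is the prime ideal generated by the variables in [Z]. *)
Definition meets Z : pred {set 'I_n} := fun U => ~~ [disjoint Z & U].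

Lemma meetsP Z U : reflect (exists2 i, i \in Z & i \in U) (meets Z U).
Proof.
rewrite /meets -setI_eq0; apply: (iffP (set0Pn _)) => -[i].
  by rewrite inE => /andP[]; exists i.
by move=> iZ iU; exists i; rewrite inE iZ.
Qed.

Lemma upclosed_meets Z : upclosed (meets Z).
Proof.
by move=> A B /subsetP AB /meetsP[i iZ iA]; apply/meetsP; exists i => //; exact: AB.
Qed.

Lemma meetsU1 x Z U : meets (x |: Z) U = meets Z U || (x \in U).
Proof.
apply/meetsP/orP => [[i]|].
  by rewrite !inE => /orP[/eqP->|iZ iU]; [right|left; apply/meetsP; exists i].
case=> [/meetsP[i iZ iU]|xU]; last by exists x; rewrite ?inE ?eqxx.
by exists i; rewrite // !inE iZ orbT.
Qed.

Lemma sqf_add_var D D' i : upclosed D' -> (forall U, D U = D' U || (i \in U)) ->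
  forall f, sqf D f <-> add1 (sqf D') 'X_i f.
Proof.
move=> up h; rewrite -mesym1_set1; apply: sqf_add => // U.
by rewrite h sub1set.
Qed.

(** Every other squarefree monomial of this degree contains a variable of [Z]. *)
Lemma mesym_meets Z : sqf (meets Z)
  ('X_[mesym1 (~: Z)] - mesym n k #|~: Z|).
Proof.
have hI := is_ideal_sqf (upclosed_meets (Z := Z)).
rewrite mesymE (bigD1 (~: Z)) //= opprD addrA subrr sub0r.
apply: (idealN hI); apply: (ideal_sum hI) => B /andP[/eqP cB nB] m.
rewrite mcoeffX; case: eqP => // <-; rewrite mnm_support_mesym1 negbK.
rewrite disjoint_sym disjoints_subset => BZ; case/eqP: nB; apply/eqP.
by rewrite eqEcard BZ cB leqnn.
Qed.

(** Induction on the number of variables outside [Z]: one of them is killed first, then moved to the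
    end of the sequence. *)
Lemma wreg_esym_meets Z v : (#|Z| + v <= n)%N -> wreg (sqf (meets Z)) (esym_seq v).
Proof.
move: {-2}(n - #|Z|)%N (erefl (n - #|Z|)%N) => N.
elim: N v Z => [|N ih] v Z hN hv.
  by have -> : v = 0%N by lia.
have hI := is_ideal_sqf (upclosed_meets (Z := Z)).
have key x : x \notin Z -> forall w, (w <= N)%N ->
    wreg (sqf (meets Z)) (rcons (esym_seq w) 'X_x).
  move=> xZ w wN; apply: wreg_move_last => //.
  - exact: homog_ideal_sqf.
  - exact: esym_seq_homog.
  - by rewrite dhomogX; apply/eqP; exact: mdeg1.
  - move=> g /sqf_colonX; apply: (sqf_congr _ g).1 => U.
    apply/meetsP/meetsP => -[i iZ].
      by rewrite in_setU1 => /orP[/eqP e|iU]; [rewrite -e iZ in xZ|exists i].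
    by move=> iU; exists i; rewrite // in_setU1 iU orbT.
  apply: (@wreg_congr _ _ (sqf (meets (x |: Z)))).
    apply: sqf_add_var; first exact: upclosed_meets.
    exact: meetsU1.
  apply: ih; first by rewrite cardsU1 xZ; lia.
  by rewrite cardsU1 xZ; lia.
have cN : #|~: Z| = N.+1 by rewrite cardsCs setCK card_ord hN.
have [x xZ] : exists x, x \notin Z.
  have /card_gt0P[x] : (0 < #|~: Z|)%N by rewrite cN.
  by rewrite inE => h; exists x.
have [vN|vN] := leqP v N; first by have /wreg_rcons[] := key x xZ v vN.
have {vN hv} -> : v = N.+1 by lia.
rewrite esym_seqS; apply/wreg_rcons; split; first by have /wreg_rcons[] := key x xZ N (leqnn _).
(* The top symmetric polynomial is congruent to the product of the remaining variables, each a
   nonzero divisor by [key]. *)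
apply: (@nonzero_divisor_congr _ _ _ _ 'X_[mesym1 (~: Z)]).
- exact: is_ideal_foldl.
- by apply: foldl_add1_mono; rewrite -cN; exact: mesym_meets.
- rewrite mpolyX_mesym1; apply: nonzero_divisor_prod => i.
  by rewrite inE => iZ; have /wreg_rcons[] := key i iZ N (leqnn _).
Qed.

(** * Regularity of the sequence on decomposable ideals *)

(* [decomposable c D]: the ideal [sqf D] unfolds, by successive exact          *)
(* sequences [0 -> S/(I:x) -> S/I -> S/(I+x) -> 0], into quotients by prime   *)
(* ideals generated by at most [c] variables.                                 *)
Inductive decomposable : nat -> pred {set 'I_n} -> Prop :=
| decomposable_full c D : (forall U, D U) -> decomposable c D
| decomposable_empty c D : (forall U, D U = false) -> decomposable c D
| decomposable_var c D D' D'' x :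
    (forall U, D' U = D (x |: U)) ->
    (forall U, D'' U = D (U :\ x)) ->
    decomposable c.+1 D' -> decomposable c D'' -> decomposable c.+1 D.

(** [Z] collects the variables killed so far; each new one is paid for by a unit of [c]. *)
Lemma wreg_esym_decomposable c D v Z : decomposable c D -> upclosed D ->
  (#|Z| + c + v <= n)%N -> wreg (sqf (fun U => meets Z U || D U)) (esym_seq v).
Proof.
move=> hD; elim: hD Z => {c D} [c D full|c D empty|c D D' D'' x hD' hD'' _ ih' _ ih''] Z up le.
- by apply: wreg_full => f m; rewrite full orbT.
- apply: (@wreg_congr _ _ (sqf (meets Z))).
    by apply: sqf_congr => U; rewrite empty orbF.
  by apply: wreg_esym_meets; lia.
have upI : upclosed (fun U => meets Z U || D U).
  move=> A B AB /orP[/(upclosed_meets AB)->//|/(up _ _ AB)->].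
  by rewrite orbT.
have up' : upclosed D'.
  by move=> A B AB; rewrite !hD'; apply: up; exact: setUS.
apply: (@wreg_extension _ _ _ 'X_x); first exact: is_ideal_sqf.
  (* If [x] is already killed, the colon ideal is the whole ring. *)
  have [xZ|xZ] := boolP (x \in Z).
    apply: wreg_full => f; apply/sqf_colonX => m.
    by rewrite (_ : meets Z _) //; apply/meetsP; exists x; rewrite // !inE eqxx.
  apply: (@wreg_congr _ _ (sqf (fun U => meets Z U || D' U))); last exact: ih'.
  move=> f; rewrite sqf_colonX; apply: sqf_congr => U; rewrite hD'; congr (_ || _).
  apply/meetsP/meetsP => -[i iZ].
    by move=> iU; exists i; rewrite // in_setU1 iU orbT.
  by rewrite in_setU1 => /orP[/eqP e|iU]; [rewrite -e iZ in xZ|exists i].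
have up'' : upclosed D''.
  by move=> A B AB; rewrite !hD''; apply: up; exact: setSD.
apply: (@wreg_congr _ _ (sqf (fun U => meets (x |: Z) U || D'' U))); last first.
  apply: ih'' => //; have := cardsU1 x Z; lia.
apply: sqf_add_var => // U; rewrite meetsU1 hD'' -!orbA; congr (_ || _).
have [xU|xU] := boolP (x \in U); rewrite ?orbT // orbF /=.
by congr D; apply/setDidPl; rewrite disjoint_sym disjoints1.
Qed.

End Squarefree.

(** * Koszul cohomology *)

Section Koszul.
Variables (k : fieldType) (n : nat).
Local Notation S := {mpoly k[n]}.
Implicit Types (I : S -> Prop) (y c : nat -> S) (r J q : nat) (D : pred {set 'I_n}) (A : {set 'I_n}).

(* All cochains of the Koszul complex of r elements: the complex of           *)
(* [y 0, ..., y r] is the mapping cone of multiplication by [y r] on the      *)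
(* complex of [y 0, ..., y (r-1)].                                            *)
Fixpoint koz r : lmodType S :=
  if r is r'.+1 then (koz r' * koz r')%type : lmodType S else S^o.

Fixpoint kdiff y r : koz r -> koz r :=
  if r is r'.+1 then fun a => (kdiff y a.1, y r' *: a.1 - kdiff y a.2)
  else fun=> 0.

(* Cohomological degree shifted by one, so that only [0] has degree [0]. *)
Fixpoint kdeg J r : koz r -> Prop :=
  if r is r'.+1 then fun a => kdeg J a.1 /\ kdeg J.-1 a.2
  else fun a => J != 1%N -> a = 0.

(** Cochains keep coefficients in [S]; this predicate says that [a] vanishes over [S/I]. *)
Fixpoint kin I r : koz r -> Prop :=
  if r is r'.+1 then fun a => kin I a.1 /\ kin I a.2 else fun a => I a.

(* A homotopy between [0] and multiplication by [\sum_i c i * y i]. *)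
Fixpoint khtp c r : koz r -> koz r :=
  if r is r'.+1 then fun a => (khtp c a.1 + c r' *: a.2, - khtp c a.2)
  else fun=> 0.

(** Internal degree is not shifted along the complex, so linear [y] make the differential raise it
    by one. *)
Fixpoint kproj q r : koz r -> koz r :=
  if r is r'.+1 then fun a => (kproj q a.1, kproj q a.2)
  else fun a => pihomog mdeg q a.

Fixpoint kunit (f : S) r : koz r :=
  if r is r'.+1 then (kunit f r', 0) else f.

(** * Linearity, degrees and the contracting homotopy of the Koszul complex *)

Lemma kdiffP y r p (a b : koz r) :
  kdiff y (p *: a + b) = p *: kdiff y a + kdiff y b.
Proof.
elim: r a b => [|r ih] a b /=; first by rewrite scaler0 addr0.
congr pair; rewrite /= ih //.
by rewrite scalerBr scalerDr !scalerA mulrC opprD !addrA; congr (_ + _); rewrite addrAC.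
Qed.

Lemma kdiff0 y r : kdiff y (0 : koz r) = 0.
Proof. by have := kdiffP y 1 (0 : koz r) 0; rewrite !scale1r addr0 => /eqP; rewrite -[X in X == _]addr0 (inj_eq (addrI _)) eq_sym => /eqP. Qed.

Lemma kdiffD y r (a b : koz r) : kdiff y (a + b) = kdiff y a + kdiff y b.
Proof. by have := kdiffP y 1 a b; rewrite !scale1r. Qed.

Lemma kdiffZ y r p (a : koz r) : kdiff y (p *: a) = p *: kdiff y a.
Proof. by have := kdiffP y p a 0; rewrite kdiff0 !addr0. Qed.

Lemma kdiffN y r (a : koz r) : kdiff y (- a) = - kdiff y a.
Proof. by rewrite -scaleN1r kdiffZ scaleN1r. Qed.

Lemma kdiffB y r (a b : koz r) : kdiff y (a - b) = kdiff y a - kdiff y b.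
Proof. by rewrite kdiffD kdiffN. Qed.

Lemma kdiffK y r (a : koz r) : kdiff y (kdiff y a) = 0.
Proof.
elim: r a => [|r ih] a //=.
by rewrite kdiffB kdiffZ !ih subr0 subrr.
Qed.

Lemma khtpP c r p (a b : koz r) :
  khtp c (p *: a + b) = p *: khtp c a + khtp c b.
Proof.
elim: r a b => [|r ih] a b /=; first by rewrite scaler0 addr0.
congr pair; rewrite /= ih ?opprD ?scalerN //.
by rewrite !scalerDr !scalerA mulrC -!addrA; congr (_ + _); rewrite addrCA.
Qed.

Lemma khtp0 c r : khtp c (0 : koz r) = 0.
Proof. by elim: r => //= r ->; rewrite scaler0 addr0 oppr0. Qed.

Lemma khtpB c r p (a b : koz r) : khtp c (p *: a - b) = p *: khtp c a - khtp c b.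
Proof.
rewrite khtpP -[in LHS]scaleN1r; have := khtpP c (-1) b 0.
by rewrite !addr0 khtp0 addr0 => ->; rewrite scaleN1r.
Qed.

(** The mixed terms cancel thanks to the sign in the second component of [khtp]. *)
Lemma khtp_homotopy y c r (a : koz r) :
  kdiff y (khtp c a) + khtp c (kdiff y a) = (\sum_(i < r) c i * y i) *: a.
Proof.
elim: r a => [|r ih] a /=; first by rewrite big_ord0 scale0r addr0.
rewrite big_ord_recr /=; set s := \sum_(i < r) _ in ih *.
congr pair; rewrite /= !(scalerDl, =^~ ih).
  rewrite kdiffD kdiffZ scalerBr -!addrA; congr (_ + _).
  by rewrite scalerA addrC -addrA subrK.
rewrite kdiffN opprK khtpB opprB scalerDr scalerA.
rewrite [y r * c r]mulrC; move: (kdiff y _) (khtp c (kdiff _ _)) (y r *: _) (_ *: a.2) => u v w z.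
by rewrite addrC -!addrA addKr [z + u]addrC addrCA.
Qed.

Lemma kdeg0 J r : kdeg J (0 : koz r).
Proof. by elim: r J => [|r ih] J //=; split. Qed.

(** Index 0 means cohomological degree -1, which makes the truncated predecessor in [kdeg]
    harmless. *)
Lemma kdeg_eq0 r (a : koz r) : kdeg 0 a -> a = 0.
Proof.
elim: r a => [|r ih] a /=; first by apply.
by case: a => a b /= [/ih -> /ih ->].
Qed.

Lemma kdegP J r p (a b : koz r) : kdeg J a -> kdeg J b -> kdeg J (p *: a + b).
Proof.
elim: r J a b => [|r ih] J a b /=.
  by move=> ha hb /[dup] /ha -> /hb ->; rewrite scaler0 addr0.
by move=> [? ?] [? ?]; split; exact: ih.
Qed.

Lemma kdegD J r (a b : koz r) : kdeg J a -> kdeg J b -> kdeg J (a + b).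
Proof. by move=> ha hb; have := kdegP 1 ha hb; rewrite scale1r. Qed.

Lemma kdegZ J r p (a : koz r) : kdeg J a -> kdeg J (p *: a).
Proof. by move=> ha; have := kdegP p ha (kdeg0 J r); rewrite addr0. Qed.

Lemma kdegB J r (a b : koz r) : kdeg J a -> kdeg J b -> kdeg J (a - b).
Proof. by move=> ha hb; have := kdegP (-1) hb ha; rewrite scaleN1r addrC. Qed.

Lemma kdeg_diff y J r (a : koz r) : kdeg J a -> kdeg J.+1 (kdiff y a).
Proof.
elim: r J a => [|r ih] J a //= [h1 h2]; split; first exact: ih.
apply: kdegB; first exact: kdegZ.
case: J h1 h2 => [|J] h1 h2; last exact: ih.
by rewrite (kdeg_eq0 h2) kdiff0; exact: kdeg0.
Qed.

Lemma kdeg_htp c J r (a : koz r) : kdeg J a -> kdeg J.-1 (khtp c a).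
Proof.
elim: r J a => [|r ih] J a //= [h1 h2]; split.
  by apply: kdegD; [exact: ih|exact: kdegZ].
by rewrite -[- _]sub0r; apply: kdegB; [exact: kdeg0|exact: ih].
Qed.

Lemma kproj0 q r : kproj q (0 : koz r) = 0.
Proof. by elim: r => [|r /= ->] //=; exact: pihomog0. Qed.

Lemma kproj_kdeg q J r (a : koz r) : kdeg J a -> kdeg J (kproj q a).
Proof.
elim: r J a => [|r ih] J a /=; first by move=> h /h ->; exact: pihomog0.
by case=> ? ?; split; exact: ih.
Qed.

Lemma kprojD q r (a b : koz r) : kproj q (a + b) = kproj q a + kproj q b.
Proof.
by elim: r a b => [|r ih] a b /=; [exact: pihomogD|congr pair; exact: ih].
Qed.

Lemma kprojN q r (a : koz r) : kproj q (- a) = - kproj q a.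
Proof.
by elim: r a => [|r ih] a /=; [exact: pihomogN|congr pair; exact: ih].
Qed.

Lemma kproj_scale q r f (a : koz r) : f \is 1.-homog ->
  kproj q (f *: a) = if q is q'.+1 then f *: kproj q' a else 0.
Proof.
move=> hf; elim: r a => [|r ih] a /=.
  rewrite [f *: _]mulrC (pihomogM _ _ hf); case: q => //= q.
  by rewrite subn1 [RHS]mulrC.
by case: q ih => [|q] ih; congr pair; exact: ih.
Qed.

Lemma kproj_diff y q r (a : koz r) : (forall i, y i \is 1.-homog) ->
  kproj q (kdiff y a) = if q is q'.+1 then kdiff y (kproj q' a) else 0.
Proof.
move=> hy; elim: r a => [|r ih] a /=; first by rewrite pihomog0; case: q.
case: q ih => [|q] ih; congr pair; rewrite /= ?kprojD ?kprojN ?ih // kproj_scale //.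
by rewrite subr0.
Qed.

Section Ideal.
Variables (I : S -> Prop) (hI : is_ideal I).

Lemma kin0 r : kin I (0 : koz r).
Proof. by elim: r => [|r ih] //=; exact: ideal0. Qed.

Lemma kinD r (a b : koz r) : kin I a -> kin I b -> kin I (a + b).
Proof.
elim: r a b => [|r ih] a b /=; first exact: idealD.
by move=> [? ?] [? ?]; split; exact: ih.
Qed.

Lemma kinZ r p (a : koz r) : kin I a -> kin I (p *: a).
Proof.
elim: r a => [|r ih] a /=; first exact: idealM.
by move=> [? ?]; split; exact: ih.
Qed.

Lemma kinN r (a : koz r) : kin I a -> kin I (- a).
Proof. by rewrite -scaleN1r; exact: kinZ. Qed.

Lemma kinB r (a b : koz r) : kin I a -> kin I b -> kin I (a - b).
Proof. by move=> ha /kinN; exact: kinD. Qed.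

Lemma kin_trans r (b a : koz r) : kin I b -> kin I (a - b) -> kin I a.
Proof. by move=> hb /kinD/(_ hb); rewrite subrK. Qed.

Lemma kin_diff y r (a : koz r) : kin I a -> kin I (kdiff y a).
Proof.
elim: r a => [|r ih] a /=; first by move=> _; exact: ideal0.
by move=> [? ?]; split; [exact: ih|apply: kinB; [exact: kinZ|exact: ih]].
Qed.

Lemma kin_htp c r (a : koz r) : kin I a -> kin I (khtp c a).
Proof.
elim: r a => [|r ih] a /=; first by move=> _; exact: ideal0.
by move=> [? ?]; split; [apply: kinD; [exact: ih|exact: kinZ]|apply/kinN/ih].
Qed.

Lemma kin_proj q r (a : koz r) : homog_ideal I -> kin I a -> kin I (kproj q a).
Proof.
move=> hh; elim: r a => [|r ih] a /=; first exact: hh.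
by move=> [? ?]; split; exact: ih.
Qed.

Lemma kin_regular r f (a : koz r) : nonzero_divisor I f ->
  kin I (f *: a) -> kin I a.
Proof.
move=> hf; elim: r a => [|r ih] a /=; first exact: hf.
by move=> [? ?]; split; exact: ih.
Qed.

(** The cofactors of [f] are chosen coefficientwise, with 0 wherever the degree forces a zero
    coefficient. *)
Lemma kin_add1 J r f (a : koz r) : kdeg J a -> kin (add1 I f) a ->
  exists2 e, kdeg J e & kin I (a - f *: e).
Proof.
elim: r J a => [|r ih] J a /=.
  move=> h [c Ic]; have [J1|J1] := boolP (J != 1%N).
    exists 0 => //; rewrite scaler0 subr0 h //; exact: ideal0.
  by exists c => //; rewrite [f *: _]mulrC.
move=> [h1 h2] [k1 k2].
have [e1 d1 i1] := ih _ _ h1 k1; have [e2 d2 i2] := ih _ _ h2 k2.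
by exists (e1, e2).
Qed.

End Ideal.

(** For positive [J], vanishing of the Koszul cohomology of [S/I] in degree [J - 1]. *)
Definition kexact y I r J := forall a : koz r, kdeg J a -> kin I (kdiff y a) ->
  exists2 b : koz r, kdeg J.-1 b & kin I (a - kdiff y b).

(** Multiplication by an element of the ideal generated by the [y i] is null-homotopic, while the
    first element of [s] is a nonzero divisor; induction handles the quotient by it. *)
Lemma kexact_wreg y r I s : is_ideal I -> wreg I s ->
  (forall f, f \in s -> exists c, f = \sum_(i < r) c i * y i) ->
  forall J, (J <= size s)%N -> kexact y I r J.
Proof.
elim: s I => [|f s ih] I hI /=.
  move=> _ _ J; rewrite leqn0 => /eqP -> a /kdeg_eq0 -> _.
  by exists 0; [exact: kdeg0|rewrite kdiff0 subr0; exact: kin0].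
move=> [hf hs] hc [|J] le a da ia.
  rewrite (kdeg_eq0 da).
  by exists 0; [exact: kdeg0|rewrite kdiff0 subr0; exact: kin0].
have [c ec] := hc f (mem_head _ _).
(* Hence [khtp c a] is a cocycle modulo [I + (f)]. *)
have hh : kin I (f *: a - kdiff y (khtp c a)).
  by rewrite ec -(khtp_homotopy y c) addrAC subrr add0r; exact: kin_htp.
have db := kdeg_htp c da.
have hI' := is_ideal_add1 hI f.
have [||g dg ig] := ih _ hI' hs _ J le _ db.
- by move=> g gs; apply: hc; rewrite in_cons gs orbT.
- have sub m (b : koz m) : kin I b -> kin (add1 I f) b.
    by elim: m b => [|m ihm] b /=; [exact: sub_add1|case=> ? ?; split; exact: ihm].
  apply: (kin_trans hI' (b := f *: a)).
    elim: (r) a {da ia hh db} => [|m ihm] a /=.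
      by rewrite [f *: _]mulrC; apply: (idealM hI'); exact: add1_gen.
    by split; exact: ihm.
  by apply: sub; rewrite -opprB; exact: kinN.
have ddg : kdeg J (kdiff y g).
  case: J dg {le ih da db ig} => [|J] dg; last exact: kdeg_diff.
  by rewrite (kdeg_eq0 dg) kdiff0; exact: kdeg0.
have [e de ie] := kin_add1 hI (kdegB db ddg) ig.
exists e; first exact: de.
(* Modulo [I], [khtp c a] is a coboundary plus [f *: e]; applying the differential gives
   [f *: a = f *: kdiff y e]. *)
apply: (kin_regular hf).
have := kinD hI hh (kin_diff hI y ie).
rewrite !kdiffB kdiffK subr0 kdiffZ.
by rewrite addrA subrK scalerBr.
Qed.

Definition knontrivial y I r J := exists q (a : koz r),
  [/\ kdeg J a, kproj q a = a, kin I (kdiff y a) &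
      ~ exists2 b : koz r, kdeg J.-1 b & kin I (a - kdiff y b)].

(* Graded Nakayama: if every class of degree [q] were [y r] times a class of  *)
(* degree [q - 1], all homogeneous classes would vanish.                      *)
Lemma knontrivialS y I r J : is_ideal I -> homog_ideal I ->
  (forall i, y i \is 1.-homog) -> (0 < J)%N ->
  knontrivial y I r J -> knontrivial y I r.+1 J.+1.
Proof.
move=> hI hh hy J0 [q]; elim/ltn_ind: q => q ih [a [da pa ia na]].
(* Either the class of [(0, a)] survives, or modulo [I] there are a cocycle [e] and some [g] with
   [a = y r *: e - kdiff y g]. *)
have [[[e g] /= [de dg] [ie ig]]|triv] := classic (exists2 b : koz r.+1,
    kdeg J b & kin I (((0, a) : koz r.+1) - kdiff y b)); last first.
  exists q, (0, a); split=> //=; first by split; first exact: kdeg0.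
    by rewrite kproj0 pa.
  by rewrite kdiff0 scaler0 sub0r; split; [exact: kin0|exact: kinN].
have := kin_proj q hh ig.
rewrite !(kprojD, kprojN) pa kproj_scale // kproj_diff //.
(* In internal degree 0 both terms on the right have zero component, so [a] would vanish. *)
case: q ih pa => [|q] ih pa.
  by rewrite !subr0 => Ia; case: na; exists 0; [exact: kdeg0|rewrite kdiff0 subr0].
move=> Iq.
have [[b db ib]|nb] := classic (exists2 b : koz r,
    kdeg J.-1 b & kin I (kproj q e - kdiff y b)).
  (* If the component of [e] were a coboundary, so would be [a]; hence it is a nontrivial class of
     smaller internal degree. *)
  case: na; exists (y r *: b - kproj q g).
    by apply: kdegB; [exact: kdegZ|exact: kproj_kdeg].
  have := kinD hI Iq (kinZ hI (y r) ib).
  by rewrite kdiffB kdiffZ !opprB scalerBr -addrA [X in kin I (a + X) -> _]addrA subrK.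
apply: (ih q (leqnn _)); exists (kproj q e); split=> //.
- exact: kproj_kdeg.
- elim: (r) (e : koz r) => [|m ihm] u /=; first exact: pihomog_id.
  by congr pair; exact: ihm.
- have := kin_proj q.+1 hh (kinN hI ie).
  by rewrite sub0r opprK kproj_diff.
Qed.

Lemma knontrivial_addn y I r m : is_ideal I -> homog_ideal I ->
  (forall i, y i \is 1.-homog) ->
  knontrivial y I r 1 -> knontrivial y I (m + r) m.+1.
Proof. by move=> hI hh hy h; elim: m => // m; exact: knontrivialS. Qed.

(** A nonzero element of [S/I] killed by all [y i] is a cocycle in degree 0, where only 0 is a
    coboundary. *)
Lemma knontrivial_unit y I r d f : is_ideal I -> f \is d.-homog ->
  ~ I f -> (forall i, (i < r)%N -> I (y i * f)) -> knontrivial y I r 1.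
Proof.
move=> hI hf nf yf; exists d, (kunit f r); split.
- by elim: r {yf} => //= m ih; split=> //; exact: kdeg0.
- elim: r {yf} => [|m /= ->] /=; first exact: pihomog_dE.
  by rewrite kproj0.
- have aux l g : I (g * f) -> kin I (g *: kunit f l).
    by elim: l => //= l ihl gf; split; [exact: ihl|rewrite scaler0; exact: kin0].
  elim: r yf => [|m ih] yf /=; first exact: ideal0.
  split; first by apply: ih => i im; apply: yf; exact: ltnW.
  by rewrite kdiff0 subr0; apply: aux; exact: yf.
- case=> b /kdeg_eq0 ->; rewrite kdiff0 subr0.
  by elim: r {yf b} => //= m ih [/ih].
Qed.

Lemma knontrivialN y I r J : kexact y I r J -> ~ knontrivial y I r J.
Proof. by move=> h [q [a [da _ ia []]]]; exact: h. Qed.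


Lemma max_ideal_gen (r : seq 'I_n) f : (forall i, i \in r) -> max_ideal f ->
  exists c : nat -> S, f = \sum_(i < size r) c i * nth 0 [seq 'X_j | j <- r] i.
Proof.
move=> rT f0.
have hg := is_ideal_gen_ideal (fun i : 'I_(size r) => nth 0 [seq 'X_j | j <- r] i : S).
suff [c ->] : gen_ideal (fun i : 'I_(size r) => nth 0 [seq 'X_j | j <- r] i) f.
  exists (fun i => oapp c 0 (insub i)); apply: eq_bigr => i _.
  by rewrite valK.
rewrite (mpolyE f); apply: (ideal_sum_seq hg) => m mf.
rewrite -mul_mpolyC; apply: (idealM hg).
have [j mj] : exists j, (U_(j) <= m)%MM.
  have : mnm_support m != set0.
    apply: contraTneq mf => e; rewrite mcoeff_msupp negbK.
    suff -> : m = 0%MM by apply/eqP.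
    by apply/mnmP => j; move/setP/(_ j): e; rewrite !inE mnm0E => /negbFE/eqP.
  by case/set0Pn => j jm; exists j; rewrite -mesym1_set1 mesym1_lem sub1set.
rewrite -(submK mj) mpolyXD; apply: (idealM hg).
have jr : (index j r < size r)%N by rewrite index_mem.
exists (fun i : 'I_(size r) => (i == Ordinal jr)%:R).
rewrite (bigD1 (Ordinal jr)) //= eqxx mul1r [X in _ + X]big1 ?addr0.
  by rewrite (nth_map j) // nth_index.
by move=> i /negPf ->; rewrite mul0r.
Qed.

(* [~: A] is a facet: [(x_a : a in A)] is an associated prime of [S/I]. *)
Lemma wreg_size_le D A (s : seq S) : upclosed D -> ~~ D (~: A) ->
  {in A, forall a, D (a |: ~: A)} ->
  (forall f, f \in s -> max_ideal f) -> wreg (sqf D) s ->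
  (size s <= #|~: A|)%N.
Proof.
move=> up nD DA hm hs; rewrite leqNgt; apply/negP => lt.
have hI := @is_ideal_sqf k _ _ up.
(* The variables of [A] come first because they kill the monomial of the facet; each later variable
   raises the degree of the class by one. *)
pose r := enum A ++ enum (~: A).
have sr : size r = (#|~: A| + #|A|)%N by rewrite size_cat -!cardE addnC.
pose y i : S := nth 0 [seq 'X_j | j <- r] i.
have := @kexact_wreg y (#|~: A| + #|A|) _ _ hI hs _ _ lt.
move/(_ _)/knontrivialN; apply.
  move=> f /hm /(@max_ideal_gen r)[] => [i|c]; last by rewrite sr; exists c.
  by rewrite mem_cat !mem_enum in_setC orbN.
apply: knontrivial_addn => //; first exact: homog_ideal_sqf.
  move=> i; rewrite /y; have [lti|gei] := ltnP i (size r).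
    have j0 : 'I_n by case: (r) lti => [|j].
    by rewrite (nth_map j0) // dhomogX; apply/eqP; exact: mdeg1.
  (* Beyond the list [y i] is 0, which is homogeneous of every degree. *)
  by rewrite nth_default ?size_map //; exact: dhomog0.
apply: (@knontrivial_unit _ _ _ (mdeg (mesym1 (~: A))) 'X_[mesym1 (~: A)]) => //.
- by rewrite dhomogX.
- move/(_ (mesym1 (~: A))); rewrite mnm_support_mesym1 mcoeffX eqxx => /(_ nD).
  by move/eqP; rewrite oner_eq0.
- move=> i iA; have lti : (i < size (enum A))%N by rewrite -cardE.
  have [a0 _] : exists a, a \in A by apply/card_gt0P; exact: leq_ltn_trans iA.
  rewrite /y /r map_cat nth_cat size_map lti (nth_map a0) //.
  apply/sqf_colonX => m; rewrite mcoeffX; case: eqP => // <-.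
  by rewrite mnm_support_mesym1 DA // -mem_enum mem_nth.
Qed.

End Koszul.

(** * Interval hypergraphs *)

Section Intervals.
Variable n : nat.
Implicit Types (U A : {set 'I_n}) (l q t : nat).
Local Open Scope nat_scope.

Definition itv a b : {set 'I_n} := [set j : 'I_n | a <= j < b].

Lemma itv_subP a b A U :
  reflect (forall j : 'I_n, a <= j < b -> j \notin A -> j \in U) (itv a b :\: A \subset U).
Proof.
apply: (iffP subsetP) => h j; last by rewrite !inE => /andP[? ?]; exact: h.
by move=> ab jA; apply: h; rewrite !inE jA.
Qed.

Lemma itv_sub0P a b U :
  reflect (forall j : 'I_n, a <= j < b -> j \in U) (itv a b \subset U).
Proof.
by apply: (iffP subsetP) => h j; [move=> ab; apply: h; rewrite inE|rewrite inE; exact: h].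
Qed.

(* The non-faces of the ideal generated by the product over [l, l + q) and    *)
(* the products over [i, i + 5) for l < i < n - 2, all cut at n, after        *)
(* inverting the variables in [l + t, l + q).                                 *)
Definition trunc_edges l q t : pred {set 'I_n} := fun U =>
  (itv l (l + t) \subset U) ||
  [exists i : 'I_n, [&& l < i, i + 2 < n &
     itv i (i + 5) :\: itv (l + t) (l + q) \subset U]].

Definition edges l q := trunc_edges l q q.

Lemma trunc_edgesP l q t U : reflect
  (itv l (l + t) \subset U \/ exists i, [/\ l < i, i + 2 < n &
     itv i (i + 5) :\: itv (l + t) (l + q) \subset U])
  (trunc_edges l q t U).
Proof.
apply: (iffP orP) => -[h|h]; [by left| |by left|]; right.
  by case/existsP: h => i /and3P[? ? ?]; exists i.
case: h => i [li il iU]; have lt : i < n by lia.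
by apply/existsP; exists (Ordinal lt); rewrite li il.
Qed.

Lemma edgesP l q U : reflect
  (itv l (l + q) \subset U \/ exists i, [/\ l < i, i + 2 < n & itv i (i + 5) \subset U])
  (edges l q U).
Proof.
have e : itv (l + q) (l + q) = set0.
  by apply/setP => j; rewrite !inE; apply/negP; lia.
by apply: (iffP (trunc_edgesP _ _ _ _)); rewrite e => -[|[i []]];
  [left| |left|]; rewrite ?setD0 //; right; exists i; rewrite ?setD0.
Qed.

Lemma upclosed_edges l q : upclosed (edges l q).
Proof.
move=> A B AB /edgesP h; apply/edgesP.
case: h => [h|[i [? ? h]]]; [left|right; exists i; split=> //]; exact: subset_trans AB.
Qed.

(** Truncated subtraction cuts the interval at 0, the type ['I_n] cuts it at [n]. *)
Lemma closed_nbhd_path_square (t : 'I_n) :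
  closed_nbhd (@path_square n) t = itv (t - 2) (t + 3).
Proof.
apply/setP => j; rewrite !inE /path_square -val_eqE /=; lia.
Qed.

(** The neighborhoods of vertices below 3 all contain that of 0; those of [t >= 3] are the intervals
    starting at [t - 2]. *)
Lemma edges_path_square U : 0 < n ->
  [exists t, closed_nbhd (@path_square n) t \subset U] = edges 0 3 U.
Proof.
move=> n0; apply/existsP/edgesP.
  case=> t; rewrite closed_nbhd_path_square => /itv_sub0P h.
  have [t3|t3] := ltnP t 3.
    by left; apply/itv_sub0P => j hj; apply: h; lia.
  right; exists (t - 2); split; [lia|have := ltn_ord t; lia|].
  by apply/itv_sub0P => j hj; apply: h; lia.
case=> [/itv_sub0P h|[i [i0 hi /itv_sub0P h]]].
  exists (Ordinal n0); rewrite closed_nbhd_path_square /=.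
  by apply/itv_sub0P => j hj; apply: h; lia.
exists (Ordinal hi); rewrite closed_nbhd_path_square /=.
by apply/itv_sub0P => j hj; apply: h; lia.
Qed.

(** All edges run up to [n], so they are nested and the one starting last decides. *)
Lemma edges_long l q U : l < n -> q <= 5 -> n <= l + q ->
  edges l q U = (itv (maxn l (n - 3)) n \subset U).
Proof.
move=> ln q5 nq; apply/edgesP/itv_sub0P.
  case=> [/itv_sub0P h j hj|[i [li hi /itv_sub0P h]] j hj]; apply: h; lia.
move=> h; have [n3|n3] := leqP n (l + 3).
  by left; apply/itv_sub0P => j hj; apply: h; have := ltn_ord j; lia.
right; exists (n - 3); split; [lia|lia|].
by apply/itv_sub0P => j hj; apply: h; have := ltn_ord j; lia.
Qed.

(** * Decomposing the interval ideals *)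

Lemma decomposable_leq c c' (D : pred {set 'I_n}) :
  c <= c' -> decomposable c D -> decomposable c' D.
Proof.
move=> le h; elim: h c' le => {c D} [c D full|c D empty|c D D' D'' x e' e'' _ ih' _ ih''] c' le.
- exact: decomposable_full.
- exact: decomposable_empty.
- case: c' le => // c' le.
  by apply: (decomposable_var e' e''); [exact: ih'|exact: ih''].
Qed.

Lemma decomposable_congr c (D D' : pred {set 'I_n}) :
  D =1 D' -> decomposable c D -> decomposable c D'.
Proof.
move=> e h; case: h e => {c D} [c D full|c D empty|c D E E' x e' e'' h' h''] e.
- by apply: decomposable_full => U; rewrite -e.
- by apply: decomposable_empty => U; rewrite -e.
- by apply: (decomposable_var (x := x)) h' h'' => U; rewrite -e.
Qed.

Lemma decomposable_subset A : decomposable 1 (fun U => A \subset U).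
Proof.
move: {-2}#|A| (erefl #|A|) => m; elim: m A => [|m ih] A cA.
  by apply: decomposable_full => U; rewrite (cards0_eq (esym cA)) sub0set.
have [x xA] : exists x, x \in A by apply/card_gt0P; rewrite -cA.
apply: (@decomposable_var _ 0 _ (fun U => A :\ x \subset U) (fun=> false) x).
- by move=> U; rewrite subDset.
- by move=> U; rewrite subsetD1 xA andbF.
- by apply: ih; have := cardsD1 x A; rewrite xA -cA => -[].
- exact: decomposable_empty.
Qed.

(** Inverting the last variable left in the first edge drops it from every edge. *)
Lemma trunc_edges_colon l q t (x : 'I_n) U : t < q -> q <= 5 -> x = l + t :> nat ->
  trunc_edges l q t U = trunc_edges l q t.+1 (x |: U).
Proof.
move=> tq q5 ex; apply/trunc_edgesP/trunc_edgesP.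
  case=> [/itv_sub0P h|[i [li hi /itv_subP h]]].
    left; apply/itv_sub0P => j hj; rewrite !inE -val_eqE /= ex.
    by have [//|ne] := eqVneq (val j) (l + t); apply: h; move/eqP: ne => /=; lia.
  right; exists i; split=> //; apply/itv_subP => j hj hj'.
  rewrite !inE -val_eqE /= ex; have [//|ne] := eqVneq (val j) (l + t).
  by apply: h => //; move: hj' ne; rewrite !inE /= => hj0 /eqP; lia.
case=> [/itv_sub0P h|[i [li hi /itv_subP h]]].
  left; apply/itv_sub0P => j hj.
  have := h j; rewrite !inE -val_eqE /= ex; case: (j \in U); lia.
right; exists i; split=> //; apply/itv_subP => j hj hj'.
have := h j hj; rewrite !inE -val_eqE /= ex; move: hj'; rewrite !inE; case: (j \in U); lia.
Qed.

(** Killing [x] removes every edge starting at or before it. Of the others, the one starting at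
    [l + t + 1] shrinks to [[l + q, l + t + 6)] and is contained in all those starting up to
    [l + q]. *)
Lemma trunc_edges_delete l q t (x : 'I_n) U :
  t < q -> q <= 5 -> x = l + t :> nat ->
  trunc_edges l q t.+1 (U :\ x) =
  (l + t + 3 < n) && edges (l + q) (t + 6 - q) U.
Proof.
move=> tq q5 ex; apply/trunc_edgesP/andP.
  case=> [/itv_sub0P/(_ x)|[i [li hi /itv_subP h]]].
    by rewrite !inE eqxx; lia.
  have ti : l + t < i.
    rewrite ltnNge; apply/negP => it; have := h x; rewrite !inE eqxx; lia.
  split; first by lia.
  have hU (j : 'I_n) : i <= j < i + 5 -> l + q <= j -> j \in U.
    by move=> hj lj; have := h j hj; rewrite !inE -val_eqE /=; case: (j \in U); lia.
  apply/edgesP; have [iq|iq] := leqP i (l + q).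
    by left; apply/itv_sub0P => j hj; apply: hU; lia.
  by right; exists i; split=> //; apply/itv_sub0P => j hj; apply: hU; lia.
case=> ht /edgesP[/itv_sub0P h|[i [li hi /itv_sub0P h]]]; right.
  exists (l + t).+1; split; [lia|lia|]; apply/itv_subP => j hj.
  rewrite !inE -val_eqE /= ex => hj'; apply/andP; split; first by lia.
  by apply: h; lia.
exists i; split; [lia|lia|]; apply/itv_subP => j hj.
rewrite !inE -val_eqE /= ex => hj'; apply/andP; split; first by lia.
by apply: h; lia.
Qed.

(** The variables of the first edge are inverted from last to first, and each deletion leaves an
    interval ideal on [N - q] vertices. The bound is the ceiling of N/3 for [q <= 3]; the correction
    for [q] equal to 4 or 5 makes it drop by one at every deletion. *)
Lemma decomposable_edges N l q : l + N = n -> 0 < N -> 0 < q <= 5 ->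
  decomposable (maxn 1 ((N + 2 - (q - 3)) %/ 3)) (edges l q).
Proof.
elim/ltn_ind: N l q => N ih l q lN N0 q5.
have [Nq|qN] := leqP N q.
  apply: (@decomposable_leq 1); first by lia.
  apply: decomposable_congr (decomposable_subset (itv (maxn l (n - 3)) n)).
  by move=> U; rewrite edges_long //; lia.
have [c ec] : exists c, maxn 1 ((N + 2 - (q - 3)) %/ 3) = c.+1.
  by exists (maxn 1 ((N + 2 - (q - 3)) %/ 3)).-1; lia.
rewrite ec; suff h t : t <= q -> decomposable c.+1 (trunc_edges l q t) by exact: h.
elim: t => [|t iht] tq.
  (* At [t = 0] the first edge is empty and the ideal is the whole ring. *)
  apply: decomposable_full => U; apply/trunc_edgesP; left.
  by apply/itv_sub0P => j; lia.
have xn : l + t < n by lia.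
apply: (@decomposable_var _ _ _ (trunc_edges l q t)
          (fun U => (l + t + 3 < n) && edges (l + q) (t + 6 - q) U) (Ordinal xn)).
- by move=> U; apply: trunc_edges_colon => //; lia.
- by move=> U; rewrite (@trunc_edges_delete l q t) //; lia.
- by apply: iht; exact: ltnW.
- case: (ltnP (l + t + 3) n) => [ht|_] /=; last exact: decomposable_empty.
  apply: decomposable_leq (ih (N - q) _ (l + q) (t + 6 - q) _ _ _); lia.
Qed.

End Intervals.

(** * Depth of the square of a path *)

Section Depth.
Variables (k : fieldType) (n : nat).
Hypothesis n0 : (0 < n)%N.
Local Notation S := {mpoly k[n]}.

Lemma NI_sqf (f : S) : @NI n k (@path_square n) f <-> sqf (@edges n 0 3) f.
Proof.
rewrite /NI gen_ideal_sqf; apply: sqf_congr => U; exact: edges_path_square.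
Qed.

(** A minimal vertex cover: its complement is the facet used for the upper bound. *)
Definition thirds : {set 'I_n} := [set i : 'I_n | (3 %| i)%N].

Lemma card_thirds : #|thirds| = ((n + 2) %/ 3)%N.
Proof.
pose f (j : 'I_((n + 2) %/ 3)) : 'I_n := insubd (Ordinal n0) (3 * j)%N.
have vf j : f j = (3 * j)%N :> nat.
  by rewrite val_insubd ifT //; have := ltn_ord j; lia.
have inj_f : injective f.
  by move=> i j /(congr1 val); rewrite /= !vf => e; apply/val_inj => /=; lia.
rewrite -[RHS]card_ord -(card_codom inj_f); apply: eq_card => i.
rewrite inE; apply/idP/codomP => [h|[j ->]]; last by rewrite vf; lia.
have lt : (i %/ 3 < (n + 2) %/ 3)%N by have := ltn_ord i; lia.
by exists (Ordinal lt); apply/val_inj; have := vf (Ordinal lt); rewrite /= => ->; lia.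
Qed.

Lemma thirds_cover : ~~ edges 0 3 (~: thirds).
Proof.
apply/edgesP => -[/itv_sub0P/(_ (Ordinal n0))|[i [i0 hi /itv_sub0P h]]].
  by rewrite !inE /=; lia.
(* The least multiple of 3 that is at least [i]; it is at most [i + 2]. *)
have lt : (3 * ((i + 2) %/ 3) < n)%N by lia.
by have := h (Ordinal lt); rewrite !inE /=; lia.
Qed.

(** The closed neighborhood of a multiple of 3 contains no other one. *)
Lemma thirds_private : {in thirds, forall a, edges 0 3 (a |: ~: thirds)}.
Proof.
move=> a; rewrite inE => a3; have := ltn_ord a; rewrite -edges_path_square // => an.
apply/existsP; exists a; rewrite closed_nbhd_path_square; apply/itv_sub0P => j hj.
by rewrite !inE -val_eqE /=; lia.
Qed.

Lemma depth_path_square : quot_depth (@NI n k (@path_square n)) (n - (n + 2) %/ 3).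
Proof.
have upE := @upclosed_edges n 0 3.
have hI := @is_ideal_sqf k _ _ upE.
have maxE f : sqf (@edges n 0 3) f -> max_ideal (f : S).
  apply; apply/edgesP => -[/itv_sub0P|[i [_ hi /itv_sub0P]]].
    by move/(_ (Ordinal n0)); rewrite inE mnm0E => /(_ isT).
  have lt : (i < n)%N by lia.
  by move/(_ (Ordinal lt)); rewrite inE mnm0E /= leqnn -{1}[i]addn0 ltn_add2l => /(_ isT).
split.
  exists (esym_seq k n (n - (n + 2) %/ 3)); first by rewrite size_map size_iota.
  have hm f : f \in esym_seq k n (n - (n + 2) %/ 3) -> max_ideal f.
    case/mapP => i _ ->; rewrite /max_ideal; apply: (@dhomog_nemf_coeff _ _ mdeg i.+1).
      exact: dhomog_mesym.
    by rewrite mf0.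
  split=> //.
    apply/wregP/(@wreg_congr _ _ (sqf (fun U => meets set0 U || edges 0 3 U))).
      move=> f; rewrite NI_sqf; apply: sqf_congr => U.
      by rewrite /meets disjoints_subset sub0set.
    apply: (@wreg_esym_decomposable _ _ ((n + 2) %/ 3)) => //.
      apply: (@decomposable_leq _ (maxn 1 ((n + 2 - (3 - 3)) %/ 3))); first by lia.
      exact: decomposable_edges.
    by rewrite cards0; lia.
  case=> c /NI_sqf /maxE.
  rewrite /max_ideal mcoeffB mcoeff1 eqxx raddf_sum /= big1 ?subr0 => [/eqP|i _].
    by rewrite oner_eq0.
  rewrite mcoeffM big1 // => -[m1 m2] /= /eqP/esym/eqP.
  rewrite mnmD_eq0 => /andP[_ /eqP ->].
  by rewrite (hm _ (mem_nth _ _)) ?mulr0.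
move=> s [hm hs _].
have -> : (n - (n + 2) %/ 3 = #|~: thirds|)%N.
  by rewrite cardsCs setCK card_ord card_thirds.
apply: (@wreg_size_le k _ (edges 0 3)) => //.
- exact: thirds_cover.
- exact: thirds_private.
- by apply: wreg_congr ((wregP _ _).2 hs); exact: NI_sqf.
Qed.

End Depth.

(** * Mapping cones of graded free resolutions *)

Section Resolution.
Variables (k : fieldType) (n : nat).
Local Notation S := {mpoly k[n]}.
Implicit Types (I : S -> Prop) (F G : free_complex k n) (p q : S) (a s t : nat).

(** Projects an arbitrary entry to an admissible one, so that ungraded solutions of homogeneous
    equations become graded ones. *)
Definition hproj a s p : S := if (s <= a)%N then pihomog mdeg (a - s)%N p else 0.

Lemma hprojP a s p : shift_homog a s (hproj a s p).
Proof. by rewrite /shift_homog /hproj; case: ifP => _; rewrite ?eqxx // pihomogP orbT. Qed.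

Lemma hproj_id a s p : shift_homog a s p -> hproj a s p = p.
Proof.
case/orP => [/eqP ->|/andP[sa hp]]; rewrite /hproj.
  by rewrite pihomog0; case: ifP.
by rewrite sa pihomog_dE.
Qed.

Lemma hproj_sum a s (T : Type) (r : seq T) (E : T -> S) :
  hproj a s (\sum_(i <- r) E i) = \sum_(i <- r) hproj a s (E i).
Proof.
by rewrite /hproj; case: ifP => _; [rewrite raddf_sum|rewrite big1].
Qed.

Lemma hprojM a s t p q : shift_homog s t q ->
  hproj a t (p * q) = hproj a s p * q.
Proof.
case/orP => [/eqP ->|/andP[ts hq]].
  by rewrite !mulr0 /hproj pihomog0; case: ifP.
rewrite /hproj; case: (leqP t a) => ta; last by rewrite leqNgt (leq_trans ta ts) mul0r.
rewrite (pihomogM _ _ hq) leq_sub2rE // subnBA // subnK //.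
by case: ifP; rewrite ?mul0r.
Qed.

Lemma shift_homog_sum a s (T : Type) (r : seq T) (E : T -> S) :
  (forall i, shift_homog a s (E i)) -> shift_homog a s (\sum_(i <- r) E i).
Proof.
move=> h; rewrite (_ : \sum_(i <- r) _ = hproj a s (\sum_(i <- r) E i)).
  exact: hprojP.
by rewrite hproj_sum; apply: eq_bigr => i _; rewrite hproj_id.
Qed.

Lemma shift_homogM a s t p q :
  shift_homog a s p -> shift_homog s t q -> shift_homog a t (p * q).
Proof.
by move=> hp hq; rewrite -(hproj_id hp) -(hprojM _ _ hq); exact: hprojP.
Qed.

Lemma shift_homog_homog a d p : p \is d.-homog -> shift_homog (a + d) a p.
Proof. by move=> hp; rewrite /shift_homog leq_addr addKn hp orbT. Qed.

Lemma shift_homogD a s d p : shift_homog a s p -> shift_homog (a + d) (s + d) p.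
Proof. by rewrite /shift_homog leq_add2r subnDr. Qed.

Definition hmatrix r m (a : 'I_r -> nat) (s : 'I_m -> nat) (M : 'M[S]_(r, m)) :=
  forall j l, shift_homog (a j) (s l) (M j l).

Lemma hmatrixM r m m' (a : 'I_r -> nat) (s : 'I_m -> nat) (t : 'I_m' -> nat) M N :
  hmatrix a s M -> hmatrix s t N -> hmatrix a t (M *m N).
Proof.
move=> hM hN j l; rewrite mxE; apply: shift_homog_sum => i.
exact: shift_homogM (hM j i) (hN i l).
Qed.

(** Treats the augmentation to [S/I] and the differentials uniformly. *)
Definition cycle I F i : 'rV[S]_(rk F i) -> Prop :=
  if i is j.+1 then fun v => v *m diff F j = 0
  else fun v => I ((v *m aug F) 0 0).

Lemma exact_cycle I F i v : exact_over I F ->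
  cycle I v <-> exists w, v = w *m @diff _ _ F i.
Proof. by case: i v => [|i] v [_ h0 hS]; [exact: h0|exact: hS]. Qed.

(** Exactness lifts each row; projecting its entries by [hproj] preserves the equation. *)
Lemma hmatrix_factor I F i r (a : 'I_r -> nat) (M : 'M[S]_(r, rk F i)) :
  graded F -> exact_over I F -> hmatrix a (@shift _ _ F i) M ->
  (forall j, cycle I (row j M)) ->
  exists2 W, hmatrix a (@shift _ _ F i.+1) W & M = W *m diff F i.
Proof.
move=> [hF _] hex hM hc.
have h j : exists w : 'rV[S]_(rk F i.+1),
    (forall l, shift_homog (a j) (shift l) (w 0 l)) /\ row j M = w *m diff F i.
  have [w ew] := (exact_cycle _ hex).1 (hc j).
  exists (\row_l hproj (a j) (shift l) (w 0 l)); split.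
    by move=> l; rewrite mxE; exact: hprojP.
  apply/rowP => l; move/rowP/(_ l): ew; rewrite !mxE => ew.
  rewrite -(hproj_id (hM j l)) ew hproj_sum; apply: eq_bigr => i' _.
  by rewrite mxE; exact: hprojM.
have {h} [f hf] := fin_all_exists h.
exists (\matrix_j f j).
  by move=> j l; rewrite mxE; case: (hf j).
by apply/row_matrixP => j; rewrite row_mul rowK; case: (hf j).
Qed.

(** * Lifting multiplication by [m] to a graded chain map *)

Section Lift.
Variables (I : S -> Prop) (m : S) (e : nat) (F G : free_complex k n).
Hypotheses (hI : is_ideal I) (hh : homog_ideal I) (hm : m \is e.-homog).
Hypotheses (gF : graded F) (gG : graded G).
Hypotheses (eF : exact_over I F) (eG : exact_over (fun f => I (m * f)) G).

(** Cycles going to cycles is exactly what the next lifting step needs. *)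
Definition liftable i (phi : 'M[S]_(rk G i, rk F i)) : Prop :=
  hmatrix (fun j => shift j + e)%N (@shift _ _ F i) phi /\
  forall v, cycle (fun f => I (m * f)) v -> cycle I (v *m phi).

Lemma lift0 : exists2 phi : 'M[S]_(rk G 0, rk F 0), liftable phi &
  forall v : 'rV_(rk G 0), I ((v *m phi *m aug F) 0 0 - m * (v *m aug G) 0 0).
Proof.
have [[u hu] _ _] := eF.
have h j : exists w : 'rV[S]_(rk F 0),
    (forall l, shift_homog (shift j + e) (shift l) (w 0 l)) /\
    I ((w *m aug F) 0 0 - m * aug G j 0).
  (* A preimage [u] of 1, scaled by [m * aug G j 0] and projected; homogeneity of [I] keeps the
     congruence. *)
  exists (\row_l hproj (shift j + e) (shift l) (m * aug G j 0 * u 0 l)); split.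
    by move=> l; rewrite mxE; exact: hprojP.
  have sh : shift_homog (shift j + e) 0 (m * aug G j 0).
    rewrite mulrC; apply: (@shift_homogM _ e).
      by have := shift_homogD e (gG.2 j); rewrite add0n.
    exact: (shift_homog_homog 0).
  have := idealM hI (m * aug G j 0) hu; rewrite mulrBr mulr1.
  move/(hh (shift j + e)%N); rewrite pihomogB.
  have E p : pihomog mdeg (shift j + e) p = hproj (shift j + e) 0 p.
    by rewrite /hproj subn0.
  rewrite !E (hproj_id sh); congr I; congr (_ - _).
  rewrite !mxE mulr_sumr hproj_sum; apply: eq_bigr => l _; rewrite mxE mulrA.
  exact: hprojM (gF.2 l).
have {h} [f hf] := fin_all_exists h.
have key v : I ((v *m \matrix_j f j *m aug F) 0 0 - m * (v *m aug G) 0 0).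
  rewrite -mulmxA [(v *m _) 0 0]mxE [(v *m aug G) 0 0]mxE mulr_sumr -sumrB.
  apply: (ideal_sum hI) => j _.
  rewrite mulrCA -mulrBr; apply: (idealM hI).
  have -> : (\matrix_j f j *m aug F) j 0 = (f j *m aug F) 0 0.
    by rewrite -[f j](rowK f) -row_mul [RHS]mxE.
  by case: (hf j).
exists (\matrix_j f j) => //; split.
  by move=> j l; rewrite mxE; case: (hf j).
by move=> v hv; apply: (ideal_trans hI hv); exact: key.
Qed.

Lemma liftS i (phi : 'M[S]_(rk G i, rk F i)) : liftable phi ->
  exists2 psi : 'M[S]_(rk G i.+1, rk F i.+1), liftable psi &
    psi *m diff F i = diff G i *m phi.
Proof.
move=> [hphi cphi].
have [||psi hpsi epsi] := @hmatrix_factor I F i _ (fun j => shift j + e)%N (diff G i *m phi) gF eF.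
- apply: hmatrixM hphi => j l; apply: shift_homogD; exact: gG.1.
- move=> j; rewrite row_mul; apply: cphi; apply/(exact_cycle _ eG).
  by exists (delta_mx 0 j); rewrite rowE.
exists psi => //; split=> // v /= hv.
by rewrite -mulmxA -epsi mulmxA hv mul0mx.
Qed.

Lemma chain_map : exists phi : forall i, 'M[S]_(rk G i, rk F i),
  [/\ forall i, hmatrix (fun j => shift j + e)%N (@shift _ _ F i) (phi i),
      forall v : 'rV_(rk G 0), I ((v *m phi 0%N *m aug F) 0 0 - m * (v *m aug G) 0 0) &
      forall i, phi i.+1 *m diff F i = diff G i *m phi i].
Proof.
have [phi0 h0 e0] := lift0.
(* Liftability is carried along so that each lift can be chosen from the preceding one. *)
pose T i := {phi : 'M[S]_(rk G i, rk F i) | liftable phi}.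
have step i (phi : T i) : {psi : T i.+1 | sval psi *m diff F i = diff G i *m sval phi}.
  apply: constructive_indefinite_description.
  have [psi hpsi epsi] := liftS (svalP phi).
  by exists (exist _ psi hpsi).
pose f := nat_rect T (exist _ phi0 h0) (fun i phi => sval (step i phi)).
exists (fun i => sval (f i)); split=> // i; first by case: (svalP (f i)).
exact: (svalP (step i (f i))).
Qed.

End Lift.

(** * The mapping cone and its exactness *)

Section Cone.
Variables (F G : free_complex k n) (x : S) (e : nat).
Variable phi : forall i, 'M[S]_(rk G i, rk F i).

(** [G] enters the cone one step later, with nothing at position 0. *)
Definition prev_rk i := if i is j.+1 then rk G j else 0%N.

Definition prev_shift i : 'I_(prev_rk i) -> nat :=
  if i is j.+1 then fun l => (shift l + e.+1)%N else fun=> 0%N.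

Definition prev_diff i : 'M[S]_(prev_rk i.+1, prev_rk i) :=
  if i is j.+1 then - diff G j else 0.

(* The cone of [x phi : G(-e-1) -> F]. *)
Definition cone : free_complex k n := @FreeComplex k n
  (fun i => rk F i + prev_rk i)%N
  (fun i j => match split j with inl l => shift l | inr l => prev_shift l end)
  (fun i => block_mx (diff F i) 0 (x *: phi i) (prev_diff i))
  (col_mx (aug F) 0).

Lemma graded_cone : graded F -> graded G -> x \is 1.-homog ->
  (forall i, hmatrix (fun j => shift j + e)%N (@shift _ _ F i) (phi i)) ->
  graded cone.
Proof.
move=> [hF aF] [hG aG] hx hphi; split=> [i j l|j] /=; rewrite !mxE.
  case: (split j) => j'; rewrite mxE; case: (split l) => l'; rewrite ?mxE.
  - exact: hF.
  - by rewrite /shift_homog eqxx.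
  - rewrite mulrC; apply: (shift_homogM (s := shift l' + 1)); last exact: shift_homog_homog.
    by rewrite addnS -addn1; apply: shift_homogD; exact: hphi.
  - case: i {j l} j' l' => [|i] j' l' /=; rewrite mxE; first by rewrite /shift_homog eqxx.
    rewrite /shift_homog oppr_eq0 rpredN; exact: shift_homogD.
by case: (split j) => j'; rewrite ?mxE //; case: j'.
Qed.

(** The factor [x] alone removes the constant terms of the comparison block, whatever [phi] is. *)
Lemma minimal_cone : minimal F -> minimal G -> x \is 1.-homog -> minimal cone.
Proof.
move=> mF mG hx i j l /=; rewrite /max_ideal !mxE.
case: (split j) => j'; rewrite mxE; case: (split l) => l'; rewrite ?mxE ?mcoeff0 //.
- exact: mF.
- rewrite (mcoeff0_is_multiplicative _ _).1 (dhomog_nemf_coeff hx) ?mul0r //.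
  by rewrite mf0.
- case: i {j l} j' l' => [|i] j' l' /=; rewrite mxE ?mcoeff0 // mcoeffN.
  by apply/eqP; rewrite oppr_eq0; apply/eqP; exact: mG.
Qed.

(** As [x] is a nonzero divisor, [I : (x * m) = I : m], so multiplication by [x * m] embeds
    [S/(I : m)] in [S/I] with cokernel [S/J]. *)
Lemma exact_cone I J m : is_ideal I -> exact_over I F ->
  exact_over (fun f => I (m * f)) G -> nonzero_divisor I x ->
  (forall f, J f <-> add1 I (x * m) f) ->
  (forall v : 'rV_(rk G 0), I ((v *m phi 0 *m aug F) 0 0 - m * (v *m aug G) 0 0)) ->
  (forall i, phi i.+1 *m diff F i = diff G i *m phi i) ->
  exact_over J cone.
Proof.
move=> hI eF eG zx hJ phi0 phiS.
(* The [G]-component of a cycle is a cycle; at [i = 0] this is where [x] is cancelled. *)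
have cG (i : nat) (a : 'rV_(rk F i.+1)) (b : 'rV_(rk G i)) :
    a *m diff F i + x *: (b *m phi i) = 0 -> b *m prev_diff i = 0 ->
    cycle (fun f => I (m * f)) b.
  case: i a b => [|i] a b /=; last by move=> _ /eqP; rewrite mulmxN oppr_eq0 => /eqP.
  move=> ab _; apply: (ideal_trans hI (g := (b *m phi 0 *m aug F) 0 0)); last first.
    by rewrite -opprB; apply: (idealN hI); exact: phi0.
  apply: zx; have : cycle I (a *m diff F 0) by apply/(exact_cycle _ eF); exists a.
  move=> /(idealN hI) /=; congr I.
  move/eqP: ab; rewrite addr_eq0 => /eqP ->.
  by rewrite mulNmx mxE opprK -scalemxAl mxE.
have entryB (M N : 'M[S]_1) c : (M - c *: N) 0 0 = M 0 0 - c * N 0 0 by rewrite !mxE.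
have entryD (M N : 'M[S]_1) c : (M + c *: N) 0 0 = M 0 0 + c * N 0 0 by rewrite !mxE.
split.
- have [[v hv] _ _] := eF; exists (row_mx v 0); apply/hJ.
  by rewrite mul_row_col mulmx0 addr0; exact: sub_add1.
- move=> v; rewrite -(hsubmxK v); set a := lsubmx v.
  have -> : rsubmx v = 0 by apply/rowP => -[].
  rewrite mul_row_col mulmx0 addr0 hJ; split.
    (* With [u] a preimage of 1, [c *: u] accounts for the multiple of [x * m]. *)
    case=> c hc; have [[u hu] _ _] := eG.
    have : cycle I (a - (x * c) *: (u *m phi 0)).
      rewrite /= mulmxBl -scalemxAl entryB.
      have := idealB hI (idealB hI hc (idealM hI (x * c) (phi0 u))) (idealM hI (x * c) hu).
      by congr I; ring.
    case/(exact_cycle _ eF) => w ew; exists (row_mx w (c *: u)).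
    rewrite /= mul_row_block !mulmx0 addr0 -ew -scalemxAl -scalemxAr scalerA [c * x]mulrC.
    by rewrite subrK.
  case=> w; rewrite -(hsubmxK w) /= mul_row_block !mulmx0 addr0 => /eq_row_mx[-> _].
  set w1 := lsubmx w; set w2 := rsubmx w; exists ((w2 *m aug G) 0 0).
  have /(idealD hI) : I ((w1 *m diff F 0 *m aug F) 0 0).
    by apply/(exact_cycle (i := 0) _ eF); exists w1.
  move=> /(_ _ (idealM hI x (phi0 w2))); congr I.
  rewrite mulmxDl -scalemxAr -scalemxAl entryD; ring.
- move=> i v; rewrite -(hsubmxK v); set a := lsubmx v; set b := rsubmx v.
  rewrite /= mul_row_block !mulmx0 add0r -scalemxAr; split.
    rewrite -row_mx0 => /eq_row_mx[ab /(cG _ _ _ ab) hb].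
    (* The preimage uses [- w], since the cone carries the negated differential of [G]. *)
    have [w ew] := (exact_cycle _ eG).1 hb.
    have : cycle I (a + x *: (w *m phi i.+1)).
      by rewrite /= mulmxDl -scalemxAl -mulmxA phiS mulmxA -ew.
    case/(exact_cycle _ eF) => u eu; exists (row_mx u (- w)).
    by rewrite mul_row_block !mulmx0 add0r -scalemxAr mulNmx scalerN mulmxN mulNmx opprK -ew -eu addrK.
  case=> w; rewrite -(hsubmxK w); set w1 := lsubmx w; set w2 := rsubmx w.
  rewrite mul_row_block !mulmx0 add0r => /eq_row_mx[-> ->].
  have dd (H : free_complex k n) (K : S -> Prop) (j : nat) (u : 'rV[S]_(rk H j.+2)) :
      exact_over K H -> u *m diff H j.+1 *m diff H j = 0.
    by move=> eH; have := (exact_cycle (i := j.+1) (u *m diff H j.+1) eH).2 (ex_intro _ u erefl).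
  rewrite mulmxDl (dd _ _ _ _ eF) add0r -row_mx0; congr row_mx.
    by rewrite /= mulmxN mulNmx scalerN -scalemxAr -scalemxAl -!mulmxA phiS subrr.
  case: i {a b v w w1} w2 => [|i] w2 /=; first by rewrite mulmx0.
  by rewrite !mulmxN mulNmx opprK (dd _ _ _ _ eG).
Qed.

End Cone.

Lemma quot_reg_congr I J r : (forall f, I f <-> J f) -> quot_reg I r -> quot_reg J r.
Proof.
move=> IJ [F [gF [[v hv] h0 hS] mF] hr]; exists F => //; split=> //; split=> //.
  by exists v; apply/IJ.
by move=> w; rewrite -IJ; exact: h0.
Qed.

(** A summand of [G] moves up one homological step and [e + 1] degrees, a net gain of [e]. The ranks
    add up, so no extremal summand is lost. *)
Lemma quot_reg_cone I J x m e r1 r2 : is_ideal I -> homog_ideal I ->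
  x \is 1.-homog -> m \is e.-homog -> nonzero_divisor I x ->
  (forall f, J f <-> add1 I (x * m) f) ->
  quot_reg I r1 -> quot_reg (fun f => I (m * f)) r2 ->
  quot_reg J (maxn r1 (r2 + e)).
Proof.
move=> hI hh hx hm zx hJ [F [gF eF mF] [[i1 [j1 s1]] le1]].
move=> [G [gG eG mG] [[i2 [j2 s2]] le2]].
have [phi [hphi phi0 phiS]] := chain_map hI hh hm gF gG eF eG.
exists (cone x e phi).
  split; [exact: graded_cone|exact: (exact_cone e hI eF eG zx hJ phi0 phiS)|exact: minimal_cone].
split; last first.
  move=> i j /=; case: (split j) => j'; first by have := le1 i j'; lia.
  by case: i {j} j' => [|i] j' /=; [lia|have := le2 i j'; lia].
have [le|lt] := leqP (r2 + e) r1.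
  exists i1, (lshift _ j1) => /=.
  by rewrite (unsplitK (inl j1)) s1; lia.
exists i2.+1, (rshift (rk F i2.+1) j2) => /=.
by rewrite (unsplitK (inr j2)) /= s2; lia.
Qed.

Lemma quot_reg0 I : (forall f, I f <-> f = 0) -> quot_reg I 0.
Proof.
move=> I0.
pose F := @FreeComplex k n (fun i => (i == 0%N) : nat) (fun _ _ => 0%N)
  (fun _ => 0) (const_mx 1).
exists F; last first.
  by split; [exists 0%N, ord0|].
split.
- split=> [i j l|j] /=; rewrite mxE /shift_homog ?eqxx //=.
  by rewrite subnn dhomog1 orbT.
- split=> [|v|i v].
  + exists (const_mx 1); apply/I0.
    by rewrite mxE big_ord1 !mxE mulr1 subrr.
  + rewrite I0 mxE big_ord1 !mxE mulr1; split=> [v0|[w ->]]; last by rewrite mulmx0 mxE.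
    by exists 0; apply/rowP => j; rewrite mulmx0 mxE ord1.
  + by split=> _; [exists 0; apply/rowP => -[]|apply/rowP => j; rewrite mulmx0].
- by move=> i j l; rewrite /max_ideal mxE mcoeff0.
Qed.

End Resolution.

(** * Regularity of the interval ideals *)

Section Regularity.
Variables (k : fieldType) (n : nat).
Implicit Types (U A : {set 'I_n}) (D : pred {set 'I_n}).
Local Notation S := {mpoly k[n]}.

(** The variable [x] divides only the generator of [A], so it is a nonzero divisor modulo [D']. *)
Lemma quot_reg_sqf D D' D'' A x r1 r2 : upclosed D' -> x \in A ->
  (forall U, D' (x |: U) = D' U) ->
  (forall U, D U = D' U || (A \subset U)) ->
  (forall U, D'' U = D' (U :|: A :\ x)) ->
  quot_reg (@sqf k n D') r1 -> quot_reg (@sqf k n D'') r2 ->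
  quot_reg (@sqf k n D) (maxn r1 (r2 + #|A|.-1)).
Proof.
move=> up xA xD DE D''E h1 h2; rewrite (cardsD1 x) xA add1n /= -(mdeg_mesym1 (A :\ x)).
apply: (quot_reg_cone (x := 'X_x) (m := 'X_[mesym1 (A :\ x)])) h1 _.
- exact: is_ideal_sqf.
- exact: homog_ideal_sqf.
- by rewrite dhomogX; apply/eqP; exact: mdeg1.
- by rewrite dhomogX.
- by move=> f /sqf_colonX; apply: (sqf_congr _ f).1.
- move=> f; rewrite (sqf_add up DE); suff -> : 'X_[mesym1 A] = 'X_x * 'X_[mesym1 (A :\ x)] :> S by [].
  by rewrite !mpolyX_mesym1 (bigD1 x) //=; congr (_ * _); apply: eq_bigl => i; rewrite !inE andbC.
- apply: quot_reg_congr h2 => f; rewrite sqf_colon mnm_support_mesym1.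
  exact: sqf_congr.
Qed.

Lemma quot_reg_sqf0 D : (forall U, D U = false) -> quot_reg (@sqf k n D) 0.
Proof.
move=> D0; apply: quot_reg0 => f; split=> [h|-> m _]; last exact: mcoeff0.
by apply/mpolyP => m; rewrite mcoeff0 h ?D0.
Qed.

Lemma quot_reg_sqf1 D A : (0 < #|A|)%N -> (forall U, D U = (A \subset U)) ->
  quot_reg (@sqf k n D) #|A|.-1.
Proof.
case/card_gt0P => x xA DE; rewrite -[#|A|.-1]max0n.
have h0 := quot_reg_sqf0 (D := fun=> false) (fun=> erefl).
by apply: (quot_reg_sqf (D' := fun=> false) (x := x) _ _ _ _ _ h0 h0).
Qed.

Lemma card_itv a b : (b <= n)%N -> #|itv n a b| = (b - a)%N.
Proof.
move=> bn; rewrite cardE -(size_map val) -(size_iota a (b - a)).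
apply: perm_size; apply: uniq_perm; rewrite ?iota_uniq ?(map_inj_uniq val_inj) ?enum_uniq //.
move=> j; rewrite mem_iota; apply/mapP/idP => [[i]|h].
  by rewrite mem_enum inE /= => hi ->; lia.
have jn : (j < n)%N by lia.
by exists (Ordinal jn); rewrite // mem_enum inE /=; lia.
Qed.

(* Meaningful for 0 < N and 0 < q <= 5, except N < 3 with q = 5. *)
Definition edges_reg N q : nat :=
  match q with
  | 1 => 2 * ((N - 1) %/ 3)
  | 2 => (2 * N - 1) %/ 3
  | 3 | 4 => (2 * N) %/ 3
  | _ => 2 * (N %/ 3)
  end.

(** The cone data for the first edge: after the colon by its other variables, the edge starting at
    [l + 1] shrinks to [[l + q, l + 6)], which lies in all those starting up to [l + q]. *)
Lemma edges_head l q (x : 'I_n) U : x = l :> nat ->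
  (l + 3 < n)%N -> (0 < q)%N ->
  [/\ edges l.+1 5 (x |: U) = edges l.+1 5 U,
      edges l q U = edges l.+1 5 U || (itv n l (l + q) \subset U) &
      (q <= 5)%N -> edges (l + q) (6 - q) U =
                    edges l.+1 5 (U :|: itv n l (l + q) :\ x)].
Proof.
move=> ex l3 q0; have up := @upclosed_edges n.
have edges5 V : edges l.+1 5 V <->
    exists i, [/\ (l < i)%N, (i + 2 < n)%N & itv n i (i + 5) \subset V].
  split=> [/edgesP[h|[i [? ? h]]]|[i [li hi h]]].
  - by exists l.+1; split=> //; lia.
  - by exists i; split=> //; lia.
  - apply/edgesP; have [e|ne] := eqVneq i l.+1; first by left; rewrite -e.
    by right; exists i; split=> //; lia.
split.
- apply/idP/idP; last by apply: up; exact: subsetUr.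
  case/edges5 => i [li hi /itv_sub0P h]; apply/edges5; exists i; split=> //.
  apply/itv_sub0P => j hj; have := h j hj; rewrite !inE -val_eqE /= ex.
  by case: eqP => // e; lia.
- apply/edgesP/orP => [[h|h]|[/edges5 h|h]]; [by right| |by right|by left].
  by left; apply/edges5.
move=> q5; apply/edgesP/idP => [h|/edges5[i [li hi /itv_sub0P h]]].
  apply/edges5; case: h => [/itv_sub0P h|[i [li hi /itv_sub0P h]]].
    exists l.+1; split; [lia|lia|]; apply/itv_sub0P => j hj.
    rewrite !inE -val_eqE /= ex; have [lt|le] := ltnP j (l + q).
      by apply/orP; right; lia.
    by rewrite h //; lia.
  by exists i; split; [lia|lia|]; apply/itv_sub0P => j hj; rewrite !inE h.
have hU (j : 'I_n) : (i <= j < i + 5)%N -> (l + q <= j)%N -> j \in U.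
  move=> hj lj; have := h j hj; rewrite !inE; case: (j \in U) => //=.
  by rewrite -val_eqE /=; lia.
have [iq|iq] := leqP i (l + q).
  by left; apply/itv_sub0P => j hj; apply: hU; lia.
by right; exists i; split=> //; apply/itv_sub0P => j hj; apply: hU; lia.
Qed.

Lemma quot_reg_edges N l q : (l + N = n)%N -> (0 < N)%N -> (0 < q <= 5)%N ->
  (q = 5 -> 3 <= N)%N -> quot_reg (@sqf k n (edges l q)) (edges_reg N q).
Proof.
elim/ltn_ind: N l q => N ih l q lN N0 q5 N3.
have [Nq|qN] := leqP N q.
  rewrite (_ : edges_reg N q = #|itv n (maxn l (n - 3)) n|.-1).
    apply: quot_reg_sqf1; first by rewrite card_itv //; lia.
    by move=> U; rewrite edges_long //; lia.
  rewrite card_itv //; move: q q5 N3 Nq; case=> [|[|[|[|[|[|q]]]]]]; rewrite /edges_reg; lia.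
(* With at most three vertices the first edge is the only one. *)
have [N4|N4] := leqP N 3.
  rewrite (_ : edges_reg N q = #|itv n l (l + q)|.-1).
    apply: quot_reg_sqf1; first by rewrite card_itv //; lia.
    move=> U; apply/edgesP/idP => [[//|[i [li hi _]]]|]; [lia|by left].
  rewrite card_itv; last by lia.
  by move: q q5 N3 qN; case=> [|[|[|[|[|[|q]]]]]]; rewrite /edges_reg; lia.
have ln : (l < n)%N by lia.
pose x := Ordinal ln.
have h U := @edges_head l q x U erefl (ltac:(lia)) (ltac:(lia)).
(* The closed form solves the cone recursion, as is checked for each [q]. *)
have -> : edges_reg N q = maxn (edges_reg N.-1 5)
    (edges_reg (N - q) (6 - q) + #|itv n l (l + q)|.-1).
  rewrite card_itv; last by lia.
  have [q' eq'] : exists q', q' = (6 - q)%N by exists (6 - q)%N.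
  rewrite -eq'; move: q q' q5 N3 qN eq' {h}.
  by case=> [|[|[|[|[|[|q]]]]]]; case=> [|[|[|[|[|[|q']]]]]]; rewrite /edges_reg; lia.
apply: (@quot_reg_sqf _ (edges l.+1 5) (edges (l + q) (6 - q)) _ x).
- exact: upclosed_edges.
- by rewrite inE /=; lia.
- by move=> U; case: (h U).
- by move=> U; case: (h U).
- by move=> U; case: (h U) => _ _; apply; lia.
- by apply: ih; lia.
- by apply: ih; lia.
Qed.

End Regularity.

Theorem corollary1p12 (k : fieldType) (n p d : nat)
    (hn : (1 <= n)%N) (hd : (d <= 5)%N) (hnpd : n = (6 * p + d)%N) :
  let v := match d with
           | 0 | 1 => (4 * p)%N
           | 2 => (4 * p + 1)%N
           | 3 | 4 => (4 * p + 2)%N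
           | _ => (4 * p + 3)%N
           end in
  quot_reg (@NI n k (@path_square n)) v /\
  quot_depth (@NI n k (@path_square n)) v.
Proof.
move=> v.
(* Both sides are the floor of 2n/3; for d = 0, ..., 5 the floor of 2d/3 is 0, 0, 1, 2, 2, 3. *)
have ev : v = edges_reg n 3.
  by rewrite /v /edges_reg hnpd; case: d hd {hnpd v} => [|[|[|[|[|[|d]]]]]] hd; lia.
split.
  apply: (@quot_reg_congr _ _ (sqf (@edges n 0 3))).
    by move=> f; rewrite NI_sqf.
  by rewrite ev; apply: quot_reg_edges.
(* The floor of 2n/3 is [n] minus the ceiling of n/3. *)
rewrite (_ : v = (n - (n + 2) %/ 3)%N); first exact: depth_path_square.
by rewrite ev /edges_reg; lia.
Qed.
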